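(* Let $(M^{2m+s},\varphi,\xi_\alpha,\eta^\alpha,g)$ be an $S$-manifold and let $F_q=q\,\Omega$ be the contact magnetic field of strength $q$, where $q\neq 0$ is a real constant. Let $\gamma:I\to M^{2m+s}$ be a unit-speed smooth curve with $T=\gamma'$. Then $\gamma$ is a slant normal magnetic curve associated to $F_q$ (i.e. $\gamma$ is slant and $\nabla_TT=-q\varphi T$) if and only if $\gamma$ belongs to the following list: a) geodesics obtained as integral curves of $\pm\frac{1}{\sqrt{s}}\sum_{\alpha=1}^{s}\xi_\alpha$; b) non-geodesic slant circles with curvature $\kappa_1=\sqrt{q^2-s}$, having contact angle $\theta=\arccos\left(\frac1q\right)$ and Frenet frame field $$\left\{T,\ \frac{-\mathrm{sgn}(q)\,\varphi T}{\sqrt{1-s\cos^2\theta}}\right\},$$ where $|q|>\sqrt{s}$; c) Legendre helices (of order $3$) with curvatures $\kappa_1=|q|$ and $\kappa_2=\sqrt{s}$, having Frenet frame field $$\left\{T,\ -\mathrm{sgn}(q)\,\varphi T,\ \frac{-\mathrm{sgn}(q)}{\sqrt{s}}\sum_{\alpha=1}^{s}\xi_\alpha\right\};$$ d) slant helices (of order $3$) with curvatures $\kappa_1=|q|\sqrt{1-s\cos^2\theta}$ and $\kappa_2=\sqrt{s}\,|1-q\cos\theta|$, having Frenet frame field $$\left\{T,\ \frac{-\mathrm{sgn}(q)\,\varphi T}{\sqrt{1-s\cos^2\theta}},\ \frac{-\varepsilon\,\mathrm{sgn}(q)}{\sqrt{s}\sqrt{1-s\cos^2\theta}}\left(-s\cos\theta\,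 T+\sum_{\alpha=1}^{s}\xi_\alpha\right)\right\},$$ where $\theta\neq\frac{\pi}{2}$ is the contact angle, satisfying $|\cos\theta|<\frac{1}{\sqrt{s}}$, and $\varepsilon=\mathrm{sgn}(1-q\cos\theta)$.
   Context: **$S$-manifolds.** Let $(M^{2m+s},g)$ be a Riemannian manifold of dimension $2m+s$, with a $(1,1)$-tensor field $\varphi$, 1-forms $\eta^\alpha$ and vector fields $\xi_\alpha$ ($\alpha=1,\dots,s$) such that for all vector fields $X,Y$: $\varphi^2=-I+\sum_{\alpha=1}^s\eta^\alpha\otimes\xi_\alpha$; $\eta^\alpha(\xi_\beta)=\delta^\alpha_\beta$; $\varphi\xi_\alpha=0$; $\eta^\alpha(\varphi X)=0$; $\eta^\alpha(X)=g(X,\xi_\alpha)$; $g(\varphi X,\varphi Y)=g(X,Y)-\sum_{\alpha=1}^s\eta^\alpha(X)\eta^\alpha(Y)$; $d\eta^\alpha(X,Y)=-d\eta^\alpha(Y,X)=g(X,\varphi Y)$ for every $\alpha$ (convention: $d\eta(X,Y)=\frac12\{X\eta(Y)-Y\eta(X)-\eta([X,Y])\}$). This is a framed $\varphi$-manifold. It is an $S$-manifold if the Nijenhuis tensor of $\varphi$ equals $-2\sum_{\alpha}d\eta^\alpha\otimes\xi_\alpha$. It is known that on an $S$-manifold, with $\nabla$ the Levi-Civita connection, $(\nabla_X\varphi)Y=\sum_{\alpha=1}^s\{g(\varphi X,\varphi Y)\xi_\alpha+\eta^\alpha(Y)\varphi^2X\}$ and $\nabla_X\xi_\alpha=-\varphi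 X$ for every $\alpha$. **Magnetic curves.** $\Omega(X,Y)=g(X,\varphi Y)$ is the (closed) fundamental 2-form and $F_q=q\Omega$. The Lorentz force $\Phi_q$, defined by $g(\Phi_qX,Y)=F_q(X,Y)$, is $\Phi_q=-q\varphi$. A normal magnetic curve associated to $F_q$ is a unit-speed smooth curve $\gamma$ with $\nabla_TT=-q\varphi T$, $T=\gamma'$. **Frenet curves.** A unit-speed curve $\gamma:I\to M$ is a Frenet curve of osculating order $r$ if there are $g$-orthonormal vector fields $T=v_1=\gamma',v_2,\dots,v_r$ along $\gamma$ (the Frenet frame field) and positive functions $\kappa_1,\dots,\kappa_{r-1}$ on $I$ (the curvatures) with $\nabla_TT=\kappa_1v_2$, $\nabla_Tv_2=-\kappa_1T+\kappa_2v_3$, ..., $\nabla_Tv_r=-\kappa_{r-1}v_{r-1}$. A geodesic is the case $r=1$; a circle is the case $r=2$ with $\kappa_1$ constant; a helix of order $r$ has osculating order $r$ and all $\kappa_i$ constant; ''helix'' means helix of order $3$. **Slant curves.** A unit-speed curve is slant if there is a constant angle $\theta$ (the contact angle) with $\eta^\alpha(T)=\cos\theta$ for all $\alpha=1,\dots,s$ (so $|\cos\theta|\le 1/\sqrt s$). It is Legendre if $\eta^\alpha(T)=0$ for all $\alpha$. *)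

(* Defs.v *)
From mathcomp Require Import all_boot all_order all_algebra.
From mathcomp Require Import all_classical all_reals all_analysis.

Set Implicit Arguments.
Unset Strict Implicit.
Unset Printing Implicit Defensive.

Import Order.TTheory GRing.Theory Num.Theory numFieldNormedType.Exports.

Local Open Scope classical_set_scope.
Local Open Scope ring_scope.

(* Coordinates in R^n, tangent vectors and covectors are row vectors; an
   endomorphism is a matrix acting on the right, v |-> v *m A. *)

Fixpoint Ck_on (R : realType) (V W : normedModType R) (k : nat) (U : set V)
    (f : V -> W) : Prop :=
  match k with
  | 0 => forall x, U x -> {for x, continuous f}
  | k'.+1 => (forall x, U x -> differentiable f x) /\
             (forall v, Ck_on k' U (fun x => 'D_v f x))
  end.

(* The intended use is for an open set U. *)
Definition smooth_on (R : realType) (V W : normedModType R) (U : set V)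
    (f : V -> W) : Prop := forall k, Ck_on k U f.

Record chart (R : realType) (n : nat) (T : topologicalType) := Chart {
  cdom : set T;
  cfun : T -> 'rV[R]_n;
  cinv : 'rV[R]_n -> T;
  cdom_open : open cdom;
  cimg_open : open (cfun @` cdom);
  cfun_continuous : forall p, cdom p -> {for p, continuous cfun};
  cinv_continuous : forall x, (cfun @` cdom) x -> {for x, continuous cinv};
  cfunK : forall p, cdom p -> cinv (cfun p) = p }.

Definition cimg (R : realType) (n : nat) (T : topologicalType)
  (c : chart R n T) : set 'rV[R]_n := cfun c @` cdom c.

(* The change of coordinates from c to d, and the open set in the coordinates
   of c on which it is meaningful. *)
Definition transition (R : realType) (n : nat) (T : topologicalType)
  (c d : chart R n T) : 'rV[R]_n -> 'rV[R]_n := fun x => cfun d (cinv c x).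

Definition overlap (R : realType) (n : nat) (T : topologicalType)
  (c d : chart R n T) : set 'rV[R]_n :=
  [set x | cimg c x /\ cdom d (cinv c x)].

Record manifold (R : realType) (n : nat) := Manifold {
  space :> topologicalType;
  space_hausdorff : hausdorff_space space;
  space_second_countable : @second_countable space;
  index : Type;
  at_chart : index -> chart R n space;
  chart_cover : forall p : space, exists i, cdom (at_chart i) p;
  chart_compat : forall i j,
    smooth_on (overlap (at_chart i) (at_chart j))
              (transition (at_chart i) (at_chart j)) }.

(* A tensor field is given by its components in every chart of the atlas; they
   are smooth on the image of the chart and obey the transformation law.
   Values outside the image of the chart are irrelevant. *)

Definition components (R : realType) (n : nat) (M : manifold R n) (A : Type) :=
  index M -> 'rV[R]_n -> A.

Definition pushfwd (R : realType) (n : nat) (M : manifold R n) (i j : index M)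
    (x v : 'rV[R]_n) : 'rV[R]_n :=
  'D_v (transition (at_chart i) (at_chart j)) x.

(* P i j x y holds whenever x and y are the coordinates in the charts i and j
   of the same point. *)
Definition on_overlaps (R : realType) (n : nat) (M : manifold R n)
    (P : index M -> index M -> 'rV[R]_n -> 'rV[R]_n -> Prop) : Prop :=
  forall i j x, overlap (at_chart i) (at_chart j) x ->
    P i j x (transition (at_chart i) (at_chart j) x).

Definition smooth_components (R : realType) (n : nat) (M : manifold R n)
    (W : normedModType R) (X : components M W) : Prop :=
  forall i, smooth_on (cimg (at_chart i)) (X i).

Definition vector_field (R : realType) (n : nat) (M : manifold R n)
    (X : components M 'rV[R]_n) : Prop :=
  smooth_components X /\
  on_overlaps (fun i j x y => X j y = pushfwd i j x (X i x)).

Definition pairing (R : realType) (n : nat) (a v : 'rV[R]_n) : R :=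
  \sum_(k < n) a 0 k * v 0 k.

Definition one_form (R : realType) (n : nat) (M : manifold R n)
    (a : components M 'rV[R]_n) : Prop :=
  smooth_components a /\
  on_overlaps (fun i j x y => forall v,
    pairing (a i x) v = pairing (a j y) (pushfwd i j x v)).

Definition endo_field (R : realType) (n : nat) (M : manifold R n)
    (A : components M 'M[R]_n) : Prop :=
  smooth_components A /\
  on_overlaps (fun i j x y => forall v,
    pushfwd i j x v *m A j y = pushfwd i j x (v *m A i x)).

Definition bform (R : realType) (n : nat) (G : 'M[R]_n) (u v : 'rV[R]_n) : R :=
  (u *m G *m v^T) 0 0.

Definition riemannian_metric (R : realType) (n : nat) (M : manifold R n)
    (g : components M 'M[R]_n) : Prop :=
  [/\ smooth_components g,
      on_overlaps (fun i j x y => forall u v,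
        bform (g i x) u v = bform (g j y) (pushfwd i j x u) (pushfwd i j x v)),
      forall i x, cimg (at_chart i) x ->
        forall u v, bform (g i x) u v = bform (g i x) v u &
      forall i x, cimg (at_chart i) x ->
        forall v, v != 0 -> 0 < bform (g i x) v v].

Definition lie_bracket (R : realType) (n : nat) (X Y : 'rV[R]_n -> 'rV[R]_n)
    : 'rV[R]_n -> 'rV[R]_n :=
  fun x => 'D_(X x) Y x - 'D_(Y x) X x.

(* d a (X, Y) = 1/2 { X a(Y) - Y a(X) - a([X, Y]) }; note the factor 1/2. *)
Definition ext_deriv (R : realType) (n : nat) (a X Y : 'rV[R]_n -> 'rV[R]_n)
    (x : 'rV[R]_n) : R :=
  2^-1 * ('D_(X x) (fun y => pairing (a y) (Y y)) x
          - 'D_(Y x) (fun y => pairing (a y) (X y)) x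
          - pairing (a x) (lie_bracket X Y x)).

(* N_A(X, Y) = A^2 [X, Y] + [A X, A Y] - A [A X, Y] - A [X, A Y] *)
Definition nijenhuis (R : realType) (n : nat) (A : 'rV[R]_n -> 'M[R]_n)
    (X Y : 'rV[R]_n -> 'rV[R]_n) (x : 'rV[R]_n) : 'rV[R]_n :=
  let AX := fun y => X y *m A y in
  let AY := fun y => Y y *m A y in
  lie_bracket X Y x *m A x *m A x + lie_bracket AX AY x
  - lie_bracket AX Y x *m A x - lie_bracket X AY x *m A x.

(* The vector Gamma(u, v) of the Levi-Civita connection of g at x, with
   components 1/2 g^{kl} (u^a v^b) (d_a g_{bl} + d_b g_{al} - d_l g_{ab}). *)
Definition christoffel (R : realType) (n : nat) (g : 'rV[R]_n -> 'M[R]_n)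
    (x u v : 'rV[R]_n) : 'rV[R]_n :=
  2^-1 *: ((v *m 'D_u g x + u *m 'D_v g x
            - \row_l bform ('D_(delta_mx 0 l) g x) u v) *m invmx (g x)).

Record framed_manifold (R : realType) (m s : nat) := FramedManifold {
  base :> manifold R (2 * m + s);
  met : components base 'M[R]_(2 * m + s);
  phi : components base 'M[R]_(2 * m + s);
  eta : 'I_s -> components base 'rV[R]_(2 * m + s);
  xi : 'I_s -> components base 'rV[R]_(2 * m + s);
  met_riemannian : riemannian_metric met;
  phi_endo : endo_field phi;
  eta_form : forall a, one_form (eta a);
  xi_field : forall a, vector_field (xi a);
  phi_sqr : forall i x, cimg (at_chart i) x -> forall v,
    v *m phi i x *m phi i x =
    - v + \sum_(a < s) pairing (eta a i x) v *: xi a i x;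
  eta_xi : forall i x, cimg (at_chart i) x -> forall a b,
    pairing (eta a i x) (xi b i x) = (a == b)%:R;
  phi_xi : forall i x, cimg (at_chart i) x -> forall a,
    xi a i x *m phi i x = 0;
  eta_phi : forall i x, cimg (at_chart i) x -> forall a v,
    pairing (eta a i x) (v *m phi i x) = 0;
  eta_met : forall i x, cimg (at_chart i) x -> forall a v,
    pairing (eta a i x) v = bform (met i x) v (xi a i x);
  met_phi : forall i x, cimg (at_chart i) x -> forall u v,
    bform (met i x) (u *m phi i x) (v *m phi i x) =
    bform (met i x) u v
    - \sum_(a < s) pairing (eta a i x) u * pairing (eta a i x) v;
  (* X and Y range over the smooth vector fields on the domain of chart i. *)
  deta_met : forall i a (X Y : 'rV[R]_(2 * m + s) -> 'rV[R]_(2 * m + s)),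
    smooth_on (cimg (at_chart i)) X -> smooth_on (cimg (at_chart i)) Y ->
    forall x, cimg (at_chart i) x ->
    ext_deriv (eta a i) X Y x = - ext_deriv (eta a i) Y X x /\
    ext_deriv (eta a i) X Y x = bform (met i x) (X x) (Y x *m phi i x) }.

Arguments met {R m s} _ _ _.
Arguments phi {R m s} _ _ _.
Arguments eta {R m s} _ _ _ _.
Arguments xi {R m s} _ _ _ _.

Definition S_manifold (R : realType) (m s : nat) (M : framed_manifold R m s)
    : Prop :=
  forall i (X Y : 'rV[R]_(2 * m + s) -> 'rV[R]_(2 * m + s)),
    smooth_on (cimg (at_chart i)) X -> smooth_on (cimg (at_chart i)) Y ->
    forall x, cimg (at_chart i) x ->
    nijenhuis (phi M i) X Y x =
    - 2 *: \sum_(a < s) ext_deriv (eta M a i) X Y x *: xi M a i x.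

(* P i t holds for every time t in I and every chart i around gamma t. *)
Definition along (R : realType) (n : nat) (M : manifold R n) (I : set R)
    (gamma : R -> M) (P : index M -> R -> Prop) : Prop :=
  forall i t, I t -> cdom (at_chart i) (gamma t) -> P i t.

Definition smooth_curve (R : realType) (n : nat) (M : manifold R n) (I : set R)
    (gamma : R -> M) : Prop :=
  (forall t, I t -> {for t, continuous gamma}) /\
  forall i, smooth_on (I `&` gamma @^-1` cdom (at_chart i))
                      (fun t => cfun (at_chart i) (gamma t)).

Definition curve_components (R : realType) (n : nat) (M : manifold R n) :=
  index M -> R -> 'rV[R]_n.

Definition field_along (R : realType) (n : nat) (M : manifold R n) (I : set R)
    (gamma : R -> M) (v : curve_components M) : Prop :=
  (forall i, smooth_on (I `&` gamma @^-1` cdom (at_chart i)) (v i)) /\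
  forall i j t, I t ->
    cdom (at_chart i) (gamma t) -> cdom (at_chart j) (gamma t) ->
    v j t = pushfwd i j (cfun (at_chart i) (gamma t)) (v i t).

Definition velocity (R : realType) (n : nat) (M : manifold R n)
    (gamma : R -> M) : curve_components M :=
  fun i t => derive1 (fun t' => cfun (at_chart i) (gamma t')) t.

Definition restrict_along (R : realType) (n : nat) (M : manifold R n)
    (A : Type) (gamma : R -> M) (X : components M A) : index M -> R -> A :=
  fun i t => X i (cfun (at_chart i) (gamma t)).

Definition cov_deriv (R : realType) (n : nat) (M : manifold R n)
    (g : components M 'M[R]_n) (gamma : R -> M) (v : curve_components M)
    : curve_components M :=
  fun i t => derive1 (v i) t +
    christoffel (g i) (cfun (at_chart i) (gamma t)) (velocity gamma i t) (v i t).

Definition integral_curve (R : realType) (n : nat) (M : manifold R n)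
    (I : set R) (gamma : R -> M) (X : components M 'rV[R]_n) : Prop :=
  along I gamma (fun i t => velocity gamma i t = restrict_along gamma X i t).

Definition unit_speed (R : realType) (n : nat) (M : manifold R n)
    (g : components M 'M[R]_n) (I : set R) (gamma : R -> M) : Prop :=
  along I gamma (fun i t =>
    bform (restrict_along gamma g i t) (velocity gamma i t)
          (velocity gamma i t) = 1).

(* vs lists v_1, ..., v_r and ks lists kappa_1, ..., kappa_(r-1), both numbered
   from 0 here; the missing v_(r+1) is read as the default value 0. *)
Definition frenet (R : realType) (n : nat) (M : manifold R n)
    (g : components M 'M[R]_n) (I : set R) (gamma : R -> M)
    (vs : seq (curve_components M)) (ks : seq (R -> R)) : Prop :=
  let v := nth (fun _ _ => 0) vs in
  let k := nth (fun _ => 0) ks in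
  [/\ size vs = (size ks).+1,
      along I gamma (fun i t => v 0%N i t = velocity gamma i t),
      forall a, (a < size vs)%N -> field_along I gamma (v a),
      along I gamma (fun i t => forall a b,
        (a < size vs)%N -> (b < size vs)%N ->
        bform (restrict_along gamma g i t) (v a i t) (v b i t) = (a == b)%:R) &
      (forall a t, (a < size ks)%N -> I t -> 0 < k a t) /\
      along I gamma (fun i t => forall a, (a < size vs)%N ->
        cov_deriv g gamma (v a) i t =
        (if a is b.+1 then - (k b t *: v b i t) else 0)
        + k a t *: v a.+1 i t)].

Definition geodesic (R : realType) (n : nat) (M : manifold R n)
    (g : components M 'M[R]_n) (I : set R) (gamma : R -> M) : Prop :=
  frenet g I gamma [:: velocity gamma] [::].

Definition circle (R : realType) (n : nat) (M : manifold R n)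
    (g : components M 'M[R]_n) (I : set R) (gamma : R -> M)
    (v1 v2 : curve_components M) (k1 : R) : Prop :=
  frenet g I gamma [:: v1; v2] [:: fun _ => k1].

Definition helix (R : realType) (n : nat) (M : manifold R n)
    (g : components M 'M[R]_n) (I : set R) (gamma : R -> M)
    (v1 v2 v3 : curve_components M) (k1 k2 : R) : Prop :=
  frenet g I gamma [:: v1; v2; v3] [:: (fun _ => k1); (fun _ => k2)].

Definition contact_angle (R : realType) (m s : nat) (M : framed_manifold R m s)
    (I : set R) (gamma : R -> M) (theta : R) : Prop :=
  0 <= theta <= pi /\
  along I gamma (fun i t => forall a : 'I_s,
    pairing (restrict_along gamma (eta M a) i t) (velocity gamma i t) =
    cos theta).

Definition slant (R : realType) (m s : nat) (M : framed_manifold R m s)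
    (I : set R) (gamma : R -> M) : Prop :=
  exists theta, contact_angle I gamma theta.

Definition legendre (R : realType) (m s : nat) (M : framed_manifold R m s)
    (I : set R) (gamma : R -> M) : Prop :=
  along I gamma (fun i t => forall a : 'I_s,
    pairing (restrict_along gamma (eta M a) i t) (velocity gamma i t) = 0).

Definition phiT (R : realType) (m s : nat) (M : framed_manifold R m s)
    (gamma : R -> M) : curve_components M :=
  fun i t => velocity gamma i t *m restrict_along gamma (phi M) i t.

Definition xi_sum (R : realType) (m s : nat) (M : framed_manifold R m s)
    : components M 'rV[R]_(2 * m + s) :=
  fun i x => \sum_(a < s) xi M a i x.

Arguments xi_sum {R m s} M _ _.

(* The Lorentz force of q Omega, where Omega(X, Y) = g(X, phi Y), is - q phi:
   g(- q phi X, Y) = q g(X, phi Y). *)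
Definition normal_magnetic (R : realType) (m s : nat)
    (M : framed_manifold R m s) (q : R) (I : set R) (gamma : R -> M) : Prop :=
  unit_speed (met M) I gamma /\
  along I gamma (fun i t =>
    cov_deriv (met M) gamma (velocity gamma) i t =
    - q *: phiT gamma i t).

(* Main.v *)
(* Put c = cos theta, rho^2 = 1 - s c^2 = |phi T|^2 and xibar = sum of the xi_a.
   On an S-manifold the identities
     nabla_X xi_a = - phi X,
     (nabla_X phi) Y = sum_a (g (phi X, phi Y) xi_a + eta^a (Y) phi^2 X)
   turn nabla_T T = - q phi T into the closed system
     nabla_T (phi T) = (1 - q c) xibar + (q - s c) T,  nabla_T xibar = - s phi T.
   Hence T, phi T, xibar - s c T are the directions of the Frenet frame, and the
   cases are rho = 0 (a), q c = 1 (b), c = 0 (c) and the others (d). Conversely,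
   the first Frenet equation of each case says that nabla_T T = - q phi T.

   Both identities are first-order consequences of the structure equations. Put
   a (u, v, w) = g ((nabla_u phi) v, w) and n_a (u, v) = g (nabla_u xi_a, v).
   The closedness of Omega = d eta^a and the normality of phi first give
   nabla_(xi_b) xi_a = 0, then that every xi_a is a Killing field, so that
   n_a = Omega; the same relations then determine a. *)

Require Import Defs.
From mathcomp Require Import all_boot all_order all_algebra.
From mathcomp Require Import all_classical all_reals all_analysis.
From mathcomp Require Import ring lra.
Import Order.TTheory GRing.Theory Num.Theory numFieldNormedType.Exports.
Set Implicit Arguments.
Unset Strict Implicit.
Unset Printing Implicit Defensive.
Local Open Scope classical_set_scope.
Local Open Scope ring_scope.

(** * Algebraic identities for the covariant derivatives of phi and xi *)

(** The two identities for nabla xi and nabla phi have to be extracted from equations given only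
    through components in a chart. Each structure equation is differentiated at a point with
    constant fields as arguments, whose brackets vanish; Christoffel symbols that are symmetric and
    metric turn the outcome into relations between the tensors [a] and [n], and what remains is
    linear algebra, carried out for abstract forms. The only second-order input is the closedness of
    Omega: since Omega = d eta^b for a single index b, whence the assumption 0 < s, it amounts to
    exchanging two directional derivatives, and this is the purpose of Schwarz's theorem here. On
    the curve, the Frenet coefficients and curvatures are kept as unknowns subject to scalar
    equations, so that c) is the value c = 0 of d) and not a separate computation. *)

Section LinearForms.
Variables (R : realFieldType) (V : lmodType R) (f : V -> R).
Hypothesis fl : linear_for *%R f.

Lemma linear_for_D u v : f (u + v) = f u + f v.
Proof. by have := fl 1 u v; rewrite scale1r mul1r. Qed.

Lemma linear_for_0 : f 0 = 0.
Proof. by have := linear_for_D 0 0; rewrite addr0; lra. Qed.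

Lemma linear_for_Z a v : f (a *: v) = a * f v.
Proof. by have := fl a v 0; rewrite !addr0 linear_for_0 addr0. Qed.

Lemma linear_for_N v : f (- v) = - f v.
Proof. by rewrite -scaleN1r linear_for_Z mulN1r. Qed.

Lemma linear_for_sum n (u : 'I_n -> V) : f (\sum_k u k) = \sum_k f (u k).
Proof. exact: (big_morph f linear_for_D linear_for_0). Qed.

End LinearForms.

Section Tensors.
Variables (R : realFieldType) (V : lmodType R) (s : nat).
Variables (g : V -> V -> R) (phi : V -> V) (xi : 'I_s -> V).
Variables (n : 'I_s -> V -> V -> R) (a : V -> V -> V -> R).
Let eta b v := g v (xi b).
Let om u v := g u (phi v).

Hypothesis gC : forall u v, g u v = g v u.
Hypothesis gl : forall w, linear_for *%R (g^~ w).
Hypothesis nl : forall b w, linear_for *%R (n b ^~ w).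
Hypothesis nr : forall b w, linear_for *%R (n b w).
Hypothesis ar : forall u v, linear_for *%R (a u v).
Hypothesis a0 : forall v w, a 0 v w = 0.
Hypothesis phiphi : forall v, phi (phi v) = - v + \sum_b eta b v *: xi b.
Hypothesis phixi : forall b, phi (xi b) = 0.
Hypothesis etaphi : forall b v, eta b (phi v) = 0.
Hypothesis omN : forall u v, om u v = - om v u.
(** Derivatives of the structure equations, in this order: skewness of [om], closedness of [om], the
    formula for phi^2, phi xi = 0, d eta = Omega (the 2 undoes the factor 1/2 in d), orthonormality
    of the xi, and normality. *)
Hypothesis aN : forall u v w, a u v w = - a u w v.
Hypothesis aC : forall u v w, a u v w + a v w u + a w u v = 0.
Hypothesis aphi : forall y w u, a y (phi w) u =
  a y w (phi u) + \sum_b (n b y w * eta b u + eta b w * n b y u).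
Hypothesis axi : forall b u v, a u (xi b) v = n b u (phi v).
Hypothesis nN : forall b u v, n b u v - n b v u = 2 * om u v.
Hypothesis nxi : forall b c u, n b u (xi c) = - n c u (xi b).
Hypothesis nij : forall u v w,
  a (phi u) v w - a (phi v) u w - a v u (phi w) + a u v (phi w) =
  - 2 * \sum_b om u v * eta b w.

Lemma linear_for_phiphi (f : V -> R) : linear_for *%R f -> forall v,
  f (phi (phi v)) = - f v + \sum_b eta b v * f (xi b).
Proof.
move=> fl v; rewrite phiphi linear_for_D // linear_for_N // linear_for_sum //.
by congr (_ + _); apply: eq_bigr => b _; exact: linear_for_Z.
Qed.

Lemma phi3 v : phi (phi (phi v)) = - phi v.
Proof.
rewrite phiphi big1 ?addr0 // => b _.
by rewrite etaphi scale0r.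
Qed.

Let om_xi u b : om u (xi b) = 0.
Proof. by rewrite /om phixi gC (linear_for_0 (gl u)). Qed.

(* This is [nij] at (u, xi b, phi w). *)
Let nij_xi b u w : - n b (phi u) w + \sum_c eta c w * n b (phi u) (xi c)
  + a (xi b) u w - \sum_c eta c w * a (xi b) u (xi c) - n b u (phi w) = 0.
Proof.
have := nij u (xi b) (phi w).
rewrite phixi a0 !axi big1 => [|c _]; last by rewrite om_xi mul0r.
rewrite phi3 (linear_for_N (nr b u)) !linear_for_phiphi //; lra.
Qed.

(** Symmetric in the last two indices because [om] vanishes on the xi, skew in the first and the
    last by [nxi]. Six alternating exchanges return the same entry with the opposite sign. *)
Let n_xi_xi b c d : n b (xi c) (xi d) = 0.
Proof.
have nsym b' c' d' : n b' (xi c') (xi d') = n b' (xi d') (xi c').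
  by have := nN b' (xi c') (xi d'); rewrite om_xi; lra.
have := nxi b d (xi c); have := nxi d c (xi b); have := nxi c b (xi d).
have := nsym b c d; have := nsym c d b; have := nsym d b c; lra.
Qed.

Let n_xi b c u : n b u (xi c) = n b (xi c) u.
Proof. by have := nN b u (xi c); rewrite om_xi; lra. Qed.

(** On the image of phi, normality at two of the xi makes n_b(xi_c, .) symmetric in b and c, while
    [nxi] and [n_xi] make it skew. The complement is spanned by the xi, where [n_xi_xi] applies. *)
Let n_xi_l b c u : n b (xi c) u = 0.
Proof.
have step v : n b (xi c) (phi v) = 0.
  have := nij_xi c (xi b) v; have := nij_xi b (xi c) v; rewrite !phixi.
  do 4! (rewrite big1 => [|d _];
    last by rewrite ?axi ?phixi ?(linear_for_0 (nl _ _)) ?(linear_for_0 (nr _ _)) mulr0).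
  rewrite !(linear_for_0 (nl _ _)) !axi.
  have := nxi b c (phi v); rewrite !n_xi; lra.
have := linear_for_phiphi (nr b (xi c)) u.
rewrite step big1 => [|d _]; last by rewrite n_xi_xi mulr0.
lra.
Qed.

Let a_xi_r u v b : a u v (xi b) = - n b u (phi v).
Proof. by rewrite aN axi. Qed.

Let a_xi_l b v w : a (xi b) v w = n b v (phi w) - n b w (phi v).
Proof. by have := aC (xi b) v w; rewrite a_xi_r axi; lra. Qed.

(** By [a_xi_l] the terms n_b(u, phi w) of [nij_xi] cancel, which leaves skewness of n_b when one
    argument is of the form phi y; the xi contribute nothing, so n_b is skew. It thus equals its
    skew part, and [nN] says that this is [om]. *)
Lemma nabla_xi_tensor b u v : n b u v = om u v.
Proof.
have sym_phi y w : n b (phi y) w + n b w (phi y) = 0.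
  have := nij_xi b y w; rewrite a_xi_l.
  do 2! (rewrite big1 => [|d _];
    last by rewrite ?a_xi_r ?n_xi n_xi_l ?oppr0 mulr0).
  lra.
have sym w : n b u w + n b w u = 0.
  have := sym_phi (phi u) w.
  rewrite (linear_for_phiphi (nl b w)) (linear_for_phiphi (nr b w)) !big1; first lra.
  - by move=> c _; rewrite n_xi n_xi_l mulr0.
  - by move=> c _; rewrite n_xi_l mulr0.
have := nN b u v; have := sym v; lra.
Qed.

Let eb v := \sum_b eta b v.
Let G u v := g (phi u) (phi v).

Let om_phil u v : om (phi u) v = G u v. Proof. by []. Qed.

Let om_phir u v : om u (phi v) = - G u v.
Proof. by rewrite omN om_phil /G gC. Qed.

Let aphi' y w u : a y (phi w) u = a y w (phi u) + (om y w * eb u + eb w * om y u).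
Proof.
rewrite aphi; congr (_ + _); rewrite /eb mulr_sumr mulr_suml -big_split.
by apply: eq_bigr => b _; rewrite /= !nabla_xi_tensor.
Qed.

(** The classical formula for nabla phi in terms of dOmega and the Nijenhuis tensor: [E2] and [E7]
    are closedness at (u, phi v, phi w) and (u, v, w), [E1] is normality at (v, w, phi u), and the
    other relations move phi from one argument to another until only a(u, v, w) is left. *)
Lemma nabla_phi_tensor u v w : a u v w = eb w * G u v - eb v * G u w.
Proof.
have ebphi x : eb (phi x) = 0 by rewrite /eb big1.
have Gsym x y : G x y = G y x by rewrite /G gC.
have aphiphi x y z : a x y (phi (phi z)) = - a x y z + eb z * G x y.
  rewrite (linear_for_phiphi (ar x y)); congr (_ + _); rewrite /eb mulr_suml.
  by apply: eq_bigr => b _; rewrite a_xi_r nabla_xi_tensor om_phir opprK.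
have E1 := nij v w (phi u).
have E2 := aC u (phi v) (phi w).
have E3 := aphi' (phi v) w u.
have E4 := aphi' (phi w) v u.
have E5 := aphi' u v (phi w).
have E6 := aN (phi w) u (phi v).
have E7 := aC u v w.
have E8 := aN w u v.
rewrite big1 in E1; last by move=> b _; rewrite etaphi mulr0.
rewrite !aphiphi in E1 E5.
rewrite !om_phil !ebphi ?om_phir in E3 E4 E5.
have := Gsym v w; have := Gsym v u; have := Gsym u w.
nra.
Qed.

End Tensors.

(** * Symmetry of second derivatives *)

Lemma derive_comp (R : realType) (V W X : normedModType R) (c : V -> W)
    (f : W -> X) (t v : V) : differentiable c t -> differentiable f (c t) ->
  'D_v (fun s => f (c s)) t = 'D_('D_v c t) f (c t).
Proof.
move=> dc df; rewrite !deriveE //; last exact: (differentiable_comp dc df).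
by rewrite (diff_comp dc df).
Qed.

Lemma eq_on_open (T : topologicalType) (X : Type) (U : set T) (f g : T -> X) :
  open U -> (forall x, U x -> f x = g x) ->
  forall x, U x -> \forall y \near x, f y = g y.
Proof.
move=> oU fg x Ux; apply: filterS (open_nbhs_nbhs (conj oU Ux)) => y Uy.
exact: fg.
Qed.

Lemma near_eq_differentiable (R : realType) (V W : normedModType R)
    (f g : V -> W) (x : V) : (\forall y \near x, f y = g y) ->
  differentiable f x -> differentiable g x.
Proof.
move=> fg df; apply/diff_locallyP.
have dc := diff_continuous df.
have /diff_locallyP [_ E] := df.
have fgx : f x = g x by exact: nbhs_singleton fg.
have H : continuous ('d f x) /\ g \o shift x = cst (g x) + 'd f x +o_ 0 id.
  split => //; apply/eqaddoP => e e0.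
  move/eqaddoP : E => /(_ e e0) E.
  have fg0 : \forall y \near (0 : V), f (y + x) = g (y + x).
    by move: (fg); rewrite (near_shift 0 x) subr0.
  near=> y; have fE : f (y + x) = g (y + x) by near: y.
  have Ey : `|(f \o shift x - (cst (f x) + 'd f x)) y| <= e * `|id y| by near: y.
  by move: Ey; rewrite !fctE /= fE fgx.
have -> : 'd g x = 'd f x :> (V -> W) by apply/diff_unique; case: H.
exact: H.
Unshelve. all: by end_near. Qed.

Lemma is_derive_segment (R : realType) (V : normedModType R) (f : V -> R)
    (x v : V) (s : R) : differentiable f (x + s *: v) ->
  is_derive s 1 (fun t => f (x + t *: v)) ('D_v f (x + s *: v)).
Proof.
move=> df.
have Ha : is_diff s (fun t : R => x + t *: v) (fun t => t *: v).
  by apply: is_diff_eq; rewrite funeqE => y /=; rewrite add0r.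
have dc : differentiable (fun t : R => x + t *: v) s by exact: ex_diff.
apply: DeriveDef; first exact/diff_derivable/(differentiable_comp dc df).
rewrite (derive_comp (1 : R) dc df); congr (derive f _ _).
by rewrite deriveE // diff_val scale1r.
Qed.

Lemma mvt_segment (R : realType) (V : normedModType R) (f : V -> R)
    (x v : V) (r : R) : 0 < r ->
  (forall s, 0 <= s <= r -> differentiable f (x + s *: v)) ->
  exists2 s, 0 <= s <= r & f (x + r *: v) - f x = r * 'D_v f (x + s *: v).
Proof.
move=> r0 df.
have [||s] := @MVT R (fun t => f (x + t *: v)) (fun s => 'D_v f (x + s *: v)) _ _ r0.
- move=> s; rewrite in_itv /= => /andP[s0 sr]; apply: is_derive_segment.
  by apply: df; rewrite !ltW.
- apply: derivable_within_continuous => s; rewrite in_itv /= => sr.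
  by have [] := is_derive_segment (df _ sr).
rewrite in_itv /= => /andP[s0 sr]; rewrite scale0r addr0 subr0 mulrC => E.
by exists s => //; rewrite !ltW.
Qed.

(* Applied to the two mixed second derivatives of [f], which both take the value
   of the second difference of [f] divided by r^2 near the corner [x]. *)
Lemma eq_at_corner (R : realType) (V : normedModType R) (U : set V)
    (k1 k2 : V -> R) (x u v : V) : nbhs x U ->
  {for x, continuous k1} -> {for x, continuous k2} ->
  (forall r, 0 < r ->
    (forall s t, 0 <= s <= r -> 0 <= t <= r -> U (x + s *: u + t *: v)) ->
    exists s t s' t', [/\ 0 <= s <= r, 0 <= t <= r, 0 <= s' <= r, 0 <= t' <= r &
      k1 (x + s *: u + t *: v) = k2 (x + s' *: u + t' *: v)]) ->
  k1 x = k2 x.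
Proof.
move=> nU /cvgrPdist_lt c1 /cvgrPdist_lt c2 k12.
apply/eqP; rewrite -subr_eq0 -normr_le0; apply/ler_addgt0Pr => e e0.
have e2 : 0 < e / 2 by rewrite divr_gt0.
have [d /= d0 dP] : exists2 d : R, 0 < d & forall y, `|x - y| < d ->
    [/\ U y, `|k1 x - k1 y| < e / 2 & `|k2 x - k2 y| < e / 2].
  have n1 : \forall y \near x, `|k1 x - k1 y| < e / 2 by exact: c1.
  have n2 : \forall y \near x, `|k2 x - k2 y| < e / 2 by exact: c2.
  have /nbhs_normP [d d0 dP] : \forall y \near x,
     [/\ U y, `|k1 x - k1 y| < e / 2 & `|k2 x - k2 y| < e / 2].
    by apply: filterS3 nU n1 n2 => y.
  by exists d => // y xy; exact: (dP y xy).
(* The parallelogram with sides r u and r v then stays within d / 2 of x; the summand 1 keeps [c]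
   positive when u = v = 0. *)
pose c := `|u| + `|v| + 1.
have c0 : 0 < c by rewrite /c; have := normr_ge0 u; have := normr_ge0 v; lra.
pose r := d / (2 * c).
have r0 : 0 < r by rewrite divr_gt0 // mulr_gt0.
have near_x s t : 0 <= s <= r -> 0 <= t <= r -> `|x - (x + s *: u + t *: v)| < d.
  move=> /andP[s0 sr] /andP[t0 tr]; rewrite -addrA opprD addrA subrr sub0r normrN.
  apply: le_lt_trans (ler_normD _ _) _; rewrite !normrZ !ger0_norm //.
  have rc : r * c = d / 2 by rewrite /r; field; rewrite gt_eqF.
  have h1 : s * `|u| <= r * `|u| by rewrite ler_wpM2r.
  have h2 : t * `|v| <= r * `|v| by rewrite ler_wpM2r.
  move: rc; rewrite /c !mulrDr mulr1; lra.
have [|s [t [s' [t' [sr tr sr' tr' E]]]]] := k12 r r0.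
  by move=> s t sr tr; have [] := dP _ (near_x s t sr tr).
have [_ H1 _] := dP _ (near_x s t sr tr).
have [_ _ H2] := dP _ (near_x s' t' sr' tr').
move: H1 H2; rewrite E !ltr_norml ler_norml; lra.
Qed.

Section Schwarz.
Variables (R : realType) (V : normedModType R) (U : set V) (f : V -> R).
Hypothesis fC2 : Ck_on 2 U f.

(** The mean value theorem twice: along u for y |-> f (y + r v) - f y, whose derivative is a
    difference of D_u f along v, then along v for D_u f. The left side is symmetric in u and v, the
    right side is not. *)
Lemma second_difference (x u v : V) (r : R) : 0 < r ->
  (forall s t, 0 <= s <= r -> 0 <= t <= r -> U (x + s *: u + t *: v)) ->
  exists s t, [/\ 0 <= s <= r, 0 <= t <= r &
    f (x + r *: u + r *: v) - f (x + r *: u) - f (x + r *: v) + f x =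
    r * (r * 'D_v ('D_u f) (x + s *: u + t *: v))].
Proof.
move=> r0 xU; have [df /(_ u)[ddf _]] := fC2.
have r00 : 0 <= r <= r by rewrite lexx ltW.
have z0 : 0 <= (0 : R) <= r by rewrite lexx ltW.
have shc (y : V) : is_diff y (fun y => y + r *: v) id.
  by apply: is_diff_eq; rewrite funeqE => z; rewrite /= addr0.
have dfr s : 0 <= s <= r -> differentiable f (x + s *: u + r *: v).
  by move=> sr; apply: df; exact: xU.
have dfs s : 0 <= s <= r -> differentiable f (x + s *: u).
  by move=> sr; apply: df; have := xU s 0 sr z0; rewrite scale0r addr0.
have dsh s : 0 <= s <= r ->
    differentiable (fun y => f (y + r *: v)) (x + s *: u).
  move=> sr; apply: (@differentiable_comp _ _ _ _ (fun y => y + r *: v) f).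
    exact: ex_diff.
  exact: dfr.
have [|s sr E] := @mvt_segment _ _ (fun y => f (y + r *: v) - f y) x u r r0.
  by move=> s sr; apply: differentiableB; [exact: dsh|exact: dfs].
have [|t tr E'] := @mvt_segment _ _ ('D_u f) (x + s *: u) v r r0.
  by move=> t tr; apply: ddf; exact: xU.
exists s, t; split => //; rewrite -E'.
have -> : f (x + r *: u + r *: v) - f (x + r *: u) - f (x + r *: v) + f x =
  f (x + r *: u + r *: v) - f (x + r *: u) - (f (x + r *: v) - f x) by ring.
rewrite E; congr (_ * _).
rewrite (@deriveB _ _ _ (fun y => f (y + r *: v)) f) /=; last 2 first.
- exact/diff_derivable/dsh.
- exact/diff_derivable/dfs.
congr (_ - _); rewrite (@derive_comp _ V V _ (fun y => y + r *: v) f).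
- congr (derive f _ _); rewrite deriveE; last exact: ex_diff.
  by rewrite diff_val.
- exact: ex_diff.
- exact: dfr.
Qed.

Lemma derive_comm (oU : open U) (x u v : V) : U x ->
  'D_v ('D_u f) x = 'D_u ('D_v f) x.
Proof.
move=> Ux; have [_ ddf] := fC2.
apply: (@eq_at_corner _ _ U _ _ x u v) ((ddf u).2 v x Ux) ((ddf v).2 u x Ux) _.
  exact: open_nbhs_nbhs.
move=> r r0 rU; have [s [t [sr tr E1]]] := @second_difference x u v r r0 rU.
have [|t' [s' [tr' sr' E2]]] := @second_difference x v u r r0.
  by move=> t' s' tr' sr'; rewrite addrAC; exact: rU.
exists s, t, s', t'; split; [exact: sr|exact: tr|exact: sr'|exact: tr'|].
have -> : x + s' *: u + t' *: v = x + t' *: v + s' *: u by rewrite addrAC.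
have rn0 : r != 0 by rewrite gt_eqF.
apply: (mulfI rn0); apply: (mulfI rn0).
have AB : x + r *: v + r *: u = x + r *: u + r *: v by rewrite addrAC.
rewrite AB [_ - f (x + r *: u)]addrAC in E2.
exact: etrans (esym E1) E2.
Qed.

End Schwarz.

(** * Calculus of smooth maps *)

Section SmoothCalculus.
Variables (R : realType) (V : normedModType R).
Implicit Type U : set V.

Lemma Ck_on_eq (W : normedModType R) k U (f g : V -> W) : open U ->
  (forall x, U x -> f x = g x) -> Ck_on k U f -> Ck_on k U g.
Proof.
move=> oU; elim: k f g => [|k IH] f g fg /=.
  move=> cf x Ux; have E := eq_on_open oU fg Ux.
  rewrite /prop_for /continuous_at -(fg _ Ux); apply: cvg_trans (cf x Ux).
  exact: near_eq_cvg.
move=> [df ddf]; split=> [x Ux|v].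
  exact: near_eq_differentiable (eq_on_open oU fg Ux) (df x Ux).
apply: IH (ddf v) => x Ux.
exact/near_eq_derive/(eq_on_open oU fg Ux).
Qed.

Lemma Ck_onW (W : normedModType R) k U (f : V -> W) :
  Ck_on k.+1 U f -> Ck_on k U f.
Proof.
elim: k f => [|k IH] f /= [df ddf].
  by move=> x Ux; exact: differentiable_continuous (df x Ux).
by split=> // v; apply: IH; exact: ddf.
Qed.

Lemma Ck_on_cst (W : normedModType R) k U (a : W) : Ck_on k U (fun=> a).
Proof.
elim: k a => [|k IH] a /=; first by move=> x _; exact: cvg_cst.
split=> [x _|v]; first exact: differentiable_cst.
have -> : 'D_v (fun=> a) = (fun=> 0) :> (V -> W); last exact: IH.
by apply/funext => x; exact: derive_cst.
Qed.

Lemma Ck_onD (W : normedModType R) k U (f g : V -> W) : open U ->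
  Ck_on k U f -> Ck_on k U g -> Ck_on k U (fun x => f x + g x).
Proof.
move=> oU; elim: k f g => [|k IH] f g /=.
  by move=> cf cg x Ux; apply: cvgD; [exact: cf|exact: cg].
move=> [df ddf] [dg ddg]; split=> [x Ux|v].
  by apply: differentiableD; [exact: df|exact: dg].
apply: Ck_on_eq (IH _ _ (ddf v) (ddg v)) => // x Ux.
by rewrite /= (@deriveD _ _ _ f g) //; apply: diff_derivable; [exact: df|exact: dg].
Qed.

Lemma Ck_on_sum (W : normedModType R) k U n (f : 'I_n -> V -> W) : open U ->
  (forall i, Ck_on k U (f i)) -> Ck_on k U (fun x => \sum_i f i x).
Proof.
move=> oU; elim: n f => [|n IH] f fk.
  apply: Ck_on_eq oU _ (Ck_on_cst k U 0) => x _; by rewrite big_ord0.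
apply: Ck_on_eq (Ck_onD oU (fk ord0) (IH _ (fun i => fk (lift ord0 i)))) => //.
by move=> x _; rewrite big_ord_recl.
Qed.

Lemma Ck_onM k U (f g : V -> R) : open U ->
  Ck_on k U f -> Ck_on k U g -> Ck_on k U (fun x => f x * g x).
Proof.
move=> oU; elim: k f g => [|k IH] f g /=.
  by move=> cf cg x Ux; apply: cvgM; [exact: cf|exact: cg].
move=> fk gk; have [df ddf] := fk; have [dg ddg] := gk.
split=> [x Ux|v]; first by apply: differentiableM; [exact: df|exact: dg].
apply: Ck_on_eq (Ck_onD oU (IH _ _ (Ck_onW fk) (ddg v))
                           (IH _ _ (Ck_onW gk) (ddf v))) => // x Ux.
by rewrite /= (@deriveM _ _ f g) //; apply: diff_derivable; [exact: df|exact: dg].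
Qed.

Lemma Ck_onZl (W : normedModType R) k U (f : V -> R) (w : W) : open U ->
  Ck_on k U f -> Ck_on k U (fun x => f x *: w).
Proof.
move=> oU; elim: k f => [|k IH] f /=.
  by move=> cf x Ux; apply: cvgZr_tmp; exact: cf.
move=> [df ddf]; split=> [x Ux|v]; first by apply: differentiableZl; exact: df.
apply: Ck_on_eq (IH _ (ddf v)) => // x Ux /=.
have dfx := df x Ux.
by rewrite (deriveE v dfx) (deriveE v (differentiableZl w dfx)) diffZl.
Qed.

Lemma differentiable_entry m n (f : V -> 'M[R]_(m, n)) i j x :
  differentiable f x -> differentiable (fun y => f y i j) x.
Proof.
move=> df; apply: (@differentiable_comp _ _ _ _ f (fun N => N i j)) => //.
exact: differentiable_coord.
Qed.

Lemma derive_entry m n (f : V -> 'M[R]_(m, n)) i j x v : differentiable f x ->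
  'D_v (fun y => f y i j) x = ('D_v f x) i j.
Proof.
by move=> df; rewrite (derive_mx (diff_derivable df)) mxE.
Qed.

Lemma Ck_on_entry m n k U (f : V -> 'M[R]_(m, n)) i j : open U ->
  Ck_on k U f -> Ck_on k U (fun x => f x i j).
Proof.
move=> oU; elim: k f => [|k IH] f /=.
  move=> cf x Ux; apply: (@continuous_comp _ _ _ f (fun N => N i j)).
    exact: cf.
  exact: coord_continuous.
move=> [df ddf]; split=> [x Ux|v]; first by apply: differentiable_entry; exact: df.
apply: Ck_on_eq (IH _ (ddf v)) => // x Ux.
by rewrite /= derive_entry //; exact: df.
Qed.

Lemma Ck_on_mx m n k U (f : V -> 'M[R]_(m, n)) : open U ->
  (forall i j, Ck_on k U (fun x => f x i j)) -> Ck_on k U f.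
Proof.
move=> oU fk.
have := Ck_on_sum oU (fun i => Ck_on_sum oU (fun j =>
  Ck_onZl (delta_mx i j : 'M[R]_(m, n)) oU (fk i j))).
apply: Ck_on_eq => // x _; by rewrite -matrix_sum_delta.
Qed.

(** The chain rule differentiates h in the direction D_v c, which moves with x, whereas [Ck_on]
    speaks of fixed directions. Expanding D_v c in the standard basis gives products of its entries
    with derivatives of h in fixed directions, to which the induction applies. *)
Lemma Ck_on_comp n k U (U' : set 'rV[R]_n) (c : V -> 'rV[R]_n) (h : 'rV[R]_n -> R) :
  open U -> (forall x, U x -> U' (c x)) ->
  Ck_on k U c -> Ck_on k U' h -> Ck_on k U (fun x => h (c x)).
Proof.
move=> oU UU'; elim: k h => [|k IH] h /=.
  move=> cc ch x Ux; apply: (@continuous_comp _ _ _ c h); first exact: cc.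
  exact: ch (UU' _ Ux).
move=> cK [dh ddh]; have [dc ddc] := cK; split=> [x Ux|v].
  by apply: (@differentiable_comp _ _ _ _ c h); [exact: dc|exact: dh (UU' _ Ux)].
have := Ck_on_sum oU (fun j : 'I_n => Ck_onM oU (Ck_on_entry 0 j oU (ddc v))
  (IH _ (Ck_onW cK) (ddh (delta_mx 0 j)))).
apply: Ck_on_eq => // x Ux.
have dhx := dh _ (UU' _ Ux); rewrite /= (derive_comp _ (dc x Ux) dhx) (deriveE _ dhx).
rewrite [in RHS](row_sum_delta (derive c x v)) linear_sum; apply: eq_bigr => j _.
by rewrite linearZ /= (deriveE _ dhx).
Qed.

Lemma smooth_on_mulmx m n p U (A : V -> 'M[R]_(m, n)) (B : V -> 'M[R]_(n, p)) :
  open U -> smooth_on U A -> smooth_on U B ->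
  smooth_on U (fun x => A x *m B x).
Proof.
move=> oU sA sB k; apply: Ck_on_mx => // i j.
have := Ck_on_sum oU (fun l : 'I_n =>
  Ck_onM oU (Ck_on_entry i l oU (sA k)) (Ck_on_entry l j oU (sB k))).
by apply: Ck_on_eq => // x _; rewrite mxE.
Qed.

Lemma smooth_onD (W : normedModType R) U (f g : V -> W) : open U ->
  smooth_on U f -> smooth_on U g -> smooth_on U (fun x => f x + g x).
Proof. by move=> oU sf sg k; exact: Ck_onD. Qed.

Lemma smooth_on_sum (W : normedModType R) U n (f : 'I_n -> V -> W) : open U ->
  (forall i, smooth_on U (f i)) -> smooth_on U (fun x => \sum_i f i x).
Proof. by move=> oU sf k; apply: Ck_on_sum => // i; exact: sf. Qed.

Lemma smooth_on_cst (W : normedModType R) U (a : W) : smooth_on U (fun=> a).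
Proof. by move=> k; exact: Ck_on_cst. Qed.

Lemma smooth_onZ m n U (a : R) (f : V -> 'M[R]_(m, n)) : open U ->
  smooth_on U f -> smooth_on U (fun x => a *: f x).
Proof.
move=> oU sf k; apply: Ck_on_mx => // i j.
have := Ck_onM oU (Ck_on_cst k U a) (Ck_on_entry i j oU (sf k)).
by apply: Ck_on_eq => // x _; rewrite mxE.
Qed.

Lemma smooth_on_derive (W : normedModType R) U (f : V -> W) v :
  smooth_on U f -> smooth_on U ('D_v f).
Proof. by move=> sf k; have [_ ddf] := sf k.+1; exact: ddf. Qed.

Lemma smooth_on_diff (W : normedModType R) U (f : V -> W) x :
  smooth_on U f -> U x -> differentiable f x.
Proof. by move=> sf; have [df _] := sf 1%N; exact: df. Qed.

Lemma derive_linear (W : normedModType R) (f : V -> W) x :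
  differentiable f x -> linear (fun v => 'D_v f x).
Proof. by move=> df a u v; rewrite !deriveE // linearP. Qed.

Lemma differentiable_mulmx m n p (A : V -> 'M[R]_(m, n)) (B : V -> 'M[R]_(n, p)) x :
  differentiable A x -> differentiable B x ->
  differentiable (fun y => A y *m B y) x.
Proof.
move=> dA dB.
have -> : (fun y => A y *m B y) =
    \sum_i \sum_j (fun y => (\sum_l (fun z => A z i l * B z l j)) y *: delta_mx i j).
  apply/funext => y; rewrite fct_sumE [LHS]matrix_sum_delta.
  apply: eq_bigr => i _; rewrite fct_sumE; apply: eq_bigr => j _.
  by rewrite mxE fct_sumE.
do 2 apply: differentiable_sum => ?.
apply: differentiableZl; apply: differentiable_sum => l.
by apply: differentiableM; exact: differentiable_entry.
Qed.

Lemma derive_mulmx m n p (A : V -> 'M[R]_(m, n)) (B : V -> 'M[R]_(n, p)) x v :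
  differentiable A x -> differentiable B x ->
  'D_v (fun y => A y *m B y) x = 'D_v A x *m B x + A x *m 'D_v B x.
Proof.
move=> dA dB; rewrite derive_mx; last exact/diff_derivable/differentiable_mulmx.
apply/matrixP => i j; rewrite !mxE -big_split.
have -> : (fun y => (A y *m B y) i j) = \sum_l (fun y => A y i l * B y l j).
  by apply/funext => y; rewrite mxE fct_sumE.
have dAi l : derivable (fun y => A y i l) x v.
  exact/diff_derivable/differentiable_entry.
have dBj l : derivable (fun y => B y l j) x v.
  exact/diff_derivable/differentiable_entry.
rewrite derive_sum; last by move=> l; apply: derivableM.
apply: eq_bigr => l _; rewrite (@deriveM _ _ (fun y => A y i l)) //.
by rewrite !derive_entry //= addrC; congr (_ + _); exact: mulrC.
Qed.

End SmoothCalculus.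

Lemma smooth_on_comp (R : realType) (V : normedModType R) m p n (U : set V)
    (U' : set 'rV[R]_n) (c : V -> 'rV[R]_n)
    (h : 'rV[R]_n -> 'M[R]_(m, p)) :
  open U -> open U' -> (forall x, U x -> U' (c x)) ->
  smooth_on U c -> smooth_on U' h -> smooth_on U (fun x => h (c x)).
Proof.
move=> oU oU' UU' sc sh k; apply: Ck_on_mx => // i j.
exact: Ck_on_comp oU UU' (sc k) (Ck_on_entry i j oU' (sh k)).
Qed.

(** * The Levi-Civita connection in a chart *)

Section Bform.
Variables (R : realType) (n : nat).
Implicit Types (G : 'M[R]_n) (u v w : 'rV[R]_n).

Lemma bformDl G u v w : bform G (u + v) w = bform G u w + bform G v w.
Proof. by rewrite /bform !mulmxDl mxE. Qed.

Lemma bformZl G a u w : bform G (a *: u) w = a * bform G u w.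
Proof. by rewrite /bform -!scalemxAl mxE. Qed.

Lemma bformNl G u w : bform G (- u) w = - bform G u w.
Proof. by rewrite -scaleN1r bformZl mulN1r. Qed.

Lemma bform0l G w : bform G 0 w = 0.
Proof. by rewrite /bform !mul0mx mxE. Qed.

Lemma bform_suml G m (f : 'I_m -> 'rV[R]_n) w :
  bform G (\sum_k f k) w = \sum_k bform G (f k) w.
Proof.
apply: (big_morph (fun u => bform G u w)); last exact: bform0l.
by move=> u v; exact: bformDl.
Qed.

Lemma bform_linearl G w : linear_for *%R ((bform G)^~ w).
Proof. by move=> a u v; rewrite bformDl bformZl. Qed.

Lemma bformDr G u v w : bform G w (u + v) = bform G w u + bform G w v.
Proof. by rewrite /bform linearD /= mulmxDr mxE. Qed.

Lemma bformZr G a u w : bform G w (a *: u) = a * bform G w u.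
Proof. by rewrite /bform linearZ /= -scalemxAr mxE. Qed.

Lemma bformNr G u w : bform G w (- u) = - bform G w u.
Proof. by rewrite -scaleN1r bformZr mulN1r. Qed.

Lemma bform0r G w : bform G w 0 = 0.
Proof. by rewrite /bform trmx0 mulmx0 mxE. Qed.

Lemma bform_sumr G m (f : 'I_m -> 'rV[R]_n) w :
  bform G w (\sum_k f k) = \sum_k bform G w (f k).
Proof.
apply: (big_morph (bform G w)); last exact: bform0r.
by move=> u v; exact: bformDr.
Qed.

Lemma pairingE (a v : 'rV[R]_n) : pairing a v = (a *m v^T) 0 0.
Proof. by rewrite mxE; apply: eq_bigr => k _; rewrite mxE. Qed.

Lemma bform_eq G u v : (forall w, w != 0 -> 0 < bform G w w) ->
  (forall w, bform G u w = bform G v w) -> u = v.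
Proof.
move=> Gpos uv; apply/eqP; rewrite -subr_eq0; apply/negPn/negP => /Gpos.
by rewrite bformDl bformNl uv subrr ltxx.
Qed.

Lemma bform_unitmx G : (forall w, w != 0 -> 0 < bform G w w) -> G \in unitmx.
Proof.
move=> Gpos; rewrite -row_free_unit -kermx_eq0; apply/eqP/row_matrixP => k.
rewrite row0; apply/eqP/negPn/negP => /Gpos.
by rewrite /bform -row_mul mulmx_ker row0 mul0mx mxE ltxx.
Qed.

End Bform.

Section Transpose.
Variables (R : realType) (V : normedModType R) (m n : nat).
Variables (A : V -> 'M[R]_(m, n)) (x : V).
Hypothesis dA : differentiable A x.

Lemma differentiable_trmx : differentiable (fun y => (A y)^T) x.
Proof.
have -> : (fun y => (A y)^T) = \sum_i \sum_j (fun y => A y j i *: delta_mx i j).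
  apply/funext => y; rewrite fct_sumE [LHS]matrix_sum_delta.
  apply: eq_bigr => i _; rewrite fct_sumE; apply: eq_bigr => j _.
  by rewrite mxE.
do 2 apply: differentiable_sum => ?.
by apply: differentiableZl; exact: differentiable_entry.
Qed.

Lemma derive_trmx v : 'D_v (fun y => (A y)^T) x = ('D_v A x)^T.
Proof.
apply/matrixP => i j; rewrite mxE.
rewrite -(derive_entry i j v differentiable_trmx) -(derive_entry j i v dA).
have -> // : (fun y => (A y)^T i j) = (fun y => A y j i).
by apply/funext => y; rewrite mxE.
Qed.

End Transpose.

Section DeriveBform.
Variables (R : realType) (n : nat) (V : normedModType R).
Variables (x v : V).

Lemma derive_bform (G : V -> 'M[R]_n) (f h : V -> 'rV[R]_n) :
  differentiable G x -> differentiable f x -> differentiable h x ->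
  'D_v (fun y => bform (G y) (f y) (h y)) x =
  bform ('D_v G x) (f x) (h x) + bform (G x) ('D_v f x) (h x) +
  bform (G x) (f x) ('D_v h x).
Proof.
move=> dG df dh; have dT := differentiable_trmx dh; have ET := derive_trmx dh v.
have dfG : differentiable (fun y => f y *m G y) x by exact: differentiable_mulmx.
rewrite /bform (@derive_entry _ _ _ _ (fun y => f y *m G y *m (h y)^T)).
  rewrite (derive_mulmx _ dfG dT) (derive_mulmx _ df dG) ET mulmxDl.
  by rewrite mxE [X in X + _ = _]mxE [X in X + _ = _]addrC.
exact: differentiable_mulmx.
Qed.

End DeriveBform.

Lemma linear_for_coord (R : realType) n (f : 'rV[R]_n -> R) w :
  linear_for *%R f -> f w = \sum_l w 0 l * f (delta_mx 0 l).
Proof.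
move=> fl; rewrite [in LHS](row_sum_delta w) linear_for_sum //.
by apply: eq_bigr => l _; rewrite linear_for_Z.
Qed.

Section Koszul.
Variables (R : realType) (n : nat) (g : 'M[R]_n).
Variables (Dg : 'rV[R]_n -> 'M[R]_n) (Gam : 'rV[R]_n -> 'rV[R]_n -> 'rV[R]_n).
Hypothesis gC : forall u v, bform g u v = bform g v u.
Hypothesis gpos : forall v, v != 0 -> 0 < bform g v v.
Hypothesis Dg_linear : linear Dg.
Hypothesis Dg_sym : forall w u v, bform (Dg w) u v = bform (Dg w) v u.
(** The Koszul formula for constant fields. It determines [Gam] through its products with every w,
    so positivity reduces symmetry and linearity to identities between values of [Dg]. *)
Hypothesis koszul : forall u v w, bform g (Gam u v) w =
  2^-1 * (bform (Dg u) v w + bform (Dg v) u w - bform (Dg w) u v).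

Lemma Dbform_linear u v : linear_for *%R (fun w => bform (Dg w) u v).
Proof.
move=> a w w'; rewrite Dg_linear /bform mulmxDr mulmxDl mxE.
by rewrite -scalemxAr -scalemxAl mxE.
Qed.

Lemma koszul_sym u v : Gam u v = Gam v u.
Proof.
apply: (bform_eq gpos) => w.
by rewrite !koszul (Dg_sym w u v); congr (_ * (_ - _)); rewrite addrC.
Qed.

Lemma koszul_linear u : linear (Gam u).
Proof.
move=> a v w; apply: (bform_eq gpos) => y.
rewrite bformDl bformZl !koszul !bformDl !bformDr !bformZl !bformZr.
rewrite (Dbform_linear u y a v w); ring.
Qed.

Lemma koszul_compat w u v :
  bform (Dg w) u v = bform g (Gam w u) v + bform g u (Gam w v).
Proof.
rewrite (gC u) !koszul.
by rewrite (Dg_sym w v u) (Dg_sym u w v) (Dg_sym v w u); field.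
Qed.

End Koszul.

Section LinearMap.
Variables (R : nzRingType) (V W : lmodType R) (L : V -> W).
Hypothesis Ll : linear L.

Lemma linear_addition v w : L (v + w) = L v + L w.
Proof. by have := Ll 1 v w; rewrite !scale1r. Qed.

Lemma linear_zero : L 0 = 0.
Proof.
by have /(congr1 (+%R^~ (- L 0))) := linear_addition 0 0;
  rewrite /= addr0 subrr addrK.
Qed.

Lemma linear_scaling a v : L (a *: v) = a *: L v.
Proof. by have := Ll a v 0; rewrite addr0 linear_zero addr0. Qed.

Lemma linear_opposite v : L (- v) = - L v.
Proof. by rewrite -scaleN1r linear_scaling scaleN1r. Qed.

Lemma linear_bigsum m (f : 'I_m -> V) : L (\sum_k f k) = \sum_k L (f k).
Proof. exact: (big_morph L linear_addition linear_zero). Qed.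

End LinearMap.

Section LeviCivita.
Variables (R : realType) (n : nat) (U : set 'rV[R]_n) (g : 'rV[R]_n -> 'M[R]_n).
Hypothesis oU : open U.
Hypothesis dg : forall x, U x -> differentiable g x.
Hypothesis gC : forall x, U x -> forall u v, bform (g x) u v = bform (g x) v u.
Hypothesis gpos : forall x, U x -> forall v, v != 0 -> 0 < bform (g x) v v.
Variable x : 'rV[R]_n.
Hypothesis Ux : U x.
Local Notation Gam := (christoffel g x).

Let Dg_linear : linear (fun w => 'D_w g x).
Proof. exact: derive_linear (dg Ux). Qed.

Let Dg_sym w u v : bform ('D_w g x) u v = bform ('D_w g x) v u.
Proof.
have E y z : bform ('D_w g x) y z = 'D_w (fun p => bform (g p) y z) x.
  rewrite (@derive_bform _ _ _ _ _ g (fun=> y) (fun=> z)) ?derive_cst //.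
    by rewrite bform0l bform0r !addr0.
  exact: dg.
rewrite !E; apply: near_eq_derive; apply: eq_on_open oU _ _ Ux => y Uy.
exact: gC.
Qed.

(** Pairing with g cancels the inverse matrix, and the row of derivatives along basis vectors pairs
    with w to the derivative along w, by linearity in the direction. *)
Lemma bform_christoffel u v w : bform (g x) (Gam u v) w =
  2^-1 * (bform ('D_u g x) v w + bform ('D_v g x) u w - bform ('D_w g x) u v).
Proof.
have gU : g x \in unitmx by exact: bform_unitmx (gpos Ux).
rewrite /christoffel bformZl; congr (_ * _).
rewrite {1}/bform mulmxKV // mulmxBl mulmxDl mxE [X in X + _ = _]mxE [X in _ + X = _]mxE.
congr (_ + _ - _); rewrite mxE.
rewrite (linear_for_coord w (Dbform_linear Dg_linear u v)).
by apply: eq_bigr => l _; rewrite !mxE mulrC.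
Qed.

Lemma christoffel_sym u v : Gam u v = Gam v u.
Proof. exact: koszul_sym (gpos Ux) Dg_sym bform_christoffel u v. Qed.

Lemma christoffel_linear u : linear (Gam u).
Proof. exact: koszul_linear (gpos Ux) Dg_linear bform_christoffel u. Qed.

Lemma metric_compat w u v :
  bform ('D_w g x) u v = bform (g x) (Gam w u) v + bform (g x) u (Gam w v).
Proof. exact: koszul_compat (gC Ux) Dg_sym bform_christoffel w u v. Qed.

End LeviCivita.

(** * Structure equations at a point *)

Section Pointwise.
Variables (R : realType) (d s : nat).
Variables (g phi : 'M[R]_d) (xi : 'I_s -> 'rV[R]_d).
Variables (Dg Dphi : 'rV[R]_d -> 'M[R]_d) (Dxi : 'I_s -> 'rV[R]_d -> 'rV[R]_d).
Variable Gam : 'rV[R]_d -> 'rV[R]_d -> 'rV[R]_d.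
Let eta b v := bform g v (xi b).

Hypothesis gC : forall u v, bform g u v = bform g v u.
Hypothesis gpos : forall v, v != 0 -> 0 < bform g v v.
Hypothesis phiphi : forall v,
  v *m phi *m phi = - v + \sum_b eta b v *: xi b.
Hypothesis phixi : forall b, xi b *m phi = 0.
Hypothesis etaphi : forall b v, eta b (v *m phi) = 0.
Hypothesis skew : forall u v, bform g u (v *m phi) = - bform g v (u *m phi).

Hypothesis Gam_sym : forall u v, Gam u v = Gam v u.
Hypothesis Gam_linear : forall u, linear (Gam u).
Hypothesis compat : forall w u v,
  bform (Dg w) u v = bform g (Gam w u) v + bform g u (Gam w v).
Hypothesis Dphi_linear : linear Dphi.
Hypothesis Dxi_linear : forall b, linear (Dxi b).

(* The first derivatives at a point of the identities which define an
   S-structure, taken along constant vector fields. *)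
Hypothesis d_skew : forall w u v,
  bform (Dg w) u (v *m phi) + bform g u (v *m Dphi w) +
  (bform (Dg w) v (u *m phi) + bform g v (u *m Dphi w)) = 0.
Hypothesis d_phiphi : forall w v,
  v *m Dphi w *m phi + v *m phi *m Dphi w =
  \sum_b ((bform (Dg w) v (xi b) + bform g v (Dxi b w)) *: xi b
          + eta b v *: Dxi b w).
Hypothesis d_phixi : forall w b, Dxi b w *m phi + xi b *m Dphi w = 0.
Hypothesis d_eta : forall b u v,
  bform (Dg u) v (xi b) + bform g v (Dxi b u)
  - (bform (Dg v) u (xi b) + bform g u (Dxi b v)) = 2 * bform g u (v *m phi).
Hypothesis d_etaxi : forall w b c,
  bform (Dg w) (xi b) (xi c) + bform g (Dxi b w) (xi c)
  + bform g (xi b) (Dxi c w) = 0.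
Hypothesis d_om : forall u v w,
  bform (Dg u) v (w *m phi) + bform g v (w *m Dphi u) +
  (bform (Dg v) w (u *m phi) + bform g w (u *m Dphi v)) +
  (bform (Dg w) u (v *m phi) + bform g u (v *m Dphi w)) = 0.
Hypothesis normal : forall u v,
  v *m Dphi (u *m phi) - u *m Dphi (v *m phi)
  + u *m Dphi v *m phi - v *m Dphi u *m phi =
  - 2 *: \sum_b bform g u (v *m phi) *: xi b.

(** The vectors nabla_u xi_b and (nabla_u phi) v. Unlike [Dxi] and [Dphi], they are tensorial and
    can be fed to the abstract algebra. *)
Let nxi b u := Dxi b u + Gam u (xi b).
Let nphi u v := v *m Dphi u + Gam u (v *m phi) - Gam u v *m phi.

Let GamD u v w : Gam u (v + w) = Gam u v + Gam u w.
Proof. exact: linear_addition. Qed.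
Let GamN u v : Gam u (- v) = - Gam u v.
Proof. exact: linear_opposite. Qed.
Let GamZ u a v : Gam u (a *: v) = a *: Gam u v.
Proof. exact: linear_scaling. Qed.
Let Gam0 u : Gam u 0 = 0.
Proof. exact: linear_zero. Qed.
Let Gam_sum u m (f : 'I_m -> 'rV[R]_d) : Gam u (\sum_k f k) = \sum_k Gam u (f k).
Proof. exact: linear_bigsum. Qed.

Let om_flip u v : bform g (u *m phi) v = - bform g u (v *m phi).
Proof. by rewrite gC skew. Qed.

Let om_nphi u v w :
  bform (Dg u) v (w *m phi) + bform g v (w *m Dphi u) =
  bform g v (nphi u w) + bform g (Gam u v) (w *m phi) + bform g v (Gam u w *m phi).
Proof. by rewrite compat /nphi !bformDr bformNr; ring. Qed.

Let n b u v := bform g (nxi b u) v.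
Let a u v w := bform g (nphi u v) w.

Let nr b w : linear_for *%R (n b w).
Proof. by move=> k u v; rewrite /n bformDr bformZr. Qed.

Let nl b w : linear_for *%R (n b ^~ w).
Proof.
move=> k u v; rewrite /n /nxi Dxi_linear ![Gam _ (xi b)]Gam_sym GamD GamZ.
by rewrite !bformDl !bformZl; ring.
Qed.

Let a0 v w : a 0 v w = 0.
Proof.
rewrite /a /nphi (linear_zero Dphi_linear) ![Gam 0 _]Gam_sym !Gam0.
by rewrite mulmx0 mul0mx addr0 subr0 bform0l.
Qed.

Let aN u v w : a u v w = - a u w v.
Proof.
have := d_skew u v w; rewrite !om_nphi.
rewrite [bform g v (_ *m phi)]skew [bform g w (Gam _ _ *m _)]skew /a.
rewrite [bform g v (nphi _ _)]gC [bform g w (nphi _ _)]gC; lra.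
Qed.

(** In the cyclic sum each Christoffel term meets, by symmetry of [Gam] and skewness of phi, one of
    the opposite sign; so dOmega = 0 becomes a relation on nabla phi alone. *)
Let aC u v w : a u v w + a v w u + a w u v = 0.
Proof.
have := d_om u v w; rewrite !om_nphi.
rewrite (Gam_sym v u) (Gam_sym w u) (Gam_sym w v).
have E1 := skew (Gam u v) w; have E2 := skew (Gam u w) v.
have E3 := skew (Gam v w) u.
have := aN u v w; have := aN v w u; have := aN w u v.
rewrite /a [bform g v (nphi _ _)]gC [bform g w (nphi _ _)]gC.
rewrite [bform g u (nphi _ _)]gC.
lra.
Qed.

Let d_eta_n b w v :
  bform (Dg w) v (xi b) + bform g v (Dxi b w) = eta b (Gam w v) + n b w v.
Proof. by rewrite compat /n /nxi [in RHS]gC bformDr /eta; ring. Qed.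

Let nphi_phi w v : nphi w v *m phi + nphi w (v *m phi) =
  \sum_b (n b w v *: xi b + eta b v *: nxi b w).
Proof.
have E : nphi w v *m phi + nphi w (v *m phi) =
    v *m Dphi w *m phi + v *m phi *m Dphi w
    + (Gam w (v *m phi *m phi) - Gam w v *m phi *m phi).
  rewrite /nphi !mulmxDl mulNmx.
  move: (_ *m Dphi w *m phi) (_ *m phi *m Dphi w).
  move: (Gam _ _ *m phi) (Gam _ _ *m phi *m phi).
  by move=> r t p q; apply/rowP => j; rewrite !mxE; ring.
rewrite E d_phiphi !phiphi GamD GamN Gam_sum opprD opprK addrACA addNr add0r.
rewrite -sumrN -!big_split; apply: eq_bigr => b _ /=.
rewrite d_eta_n GamZ /nxi scalerDl scalerDr.
by apply/rowP => j; rewrite !mxE; ring.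
Qed.

Let aphi y w u : a y (w *m phi) u =
  a y w (u *m phi) + \sum_b (n b y w * eta b u + eta b w * n b y u).
Proof.
have := congr1 (fun z => bform g z u) (nphi_phi y w).
rewrite bformDl om_flip bform_suml => E.
rewrite /a (_ : bform g (nphi y (w *m phi)) u =
  bform g (nphi y w) (u *m phi) + (- bform g (nphi y w) (u *m phi)
  + bform g (nphi y (w *m phi)) u)); last by ring.
rewrite E; congr (_ + _); apply: eq_bigr => b _.
by rewrite bformDl !bformZl /eta [bform g (xi b) u]gC.
Qed.

Let axi b u v : a u (xi b) v = n b u (v *m phi).
Proof.
rewrite /a /n -[RHS]opprK -om_flip -bformNl; congr (bform _ _ _).
rewrite /nphi phixi Gam0 addr0 /nxi mulmxDl opprD; congr (_ - _).
by apply/eqP; rewrite -addr_eq0 addrC d_phixi.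
Qed.

Let nN b u v : n b u v - n b v u = 2 * bform g u (v *m phi).
Proof. by have := d_eta b u v; rewrite !d_eta_n (Gam_sym v u) => <-; ring. Qed.

Let nxiN b c u : n b u (xi c) = - n c u (xi b).
Proof.
have := d_etaxi u b c; rewrite compat /n /nxi !bformDl.
rewrite [bform g (xi b) _]gC [bform g (xi b) (Dxi _ _)]gC; lra.
Qed.

(** The Nijenhuis tensor is the same whether computed with D or with nabla, because the Christoffel
    terms cancel by symmetry of [Gam]. *)
Let nij u v w :
  a (u *m phi) v w - a (v *m phi) u w - a v u (w *m phi) + a u v (w *m phi) =
  - 2 * \sum_b bform g u (v *m phi) * eta b w.
Proof.
have := congr1 (fun z => bform g z w) (normal u v).
rewrite bformZl bform_suml.
under [in RHS]eq_bigr => b _ do rewrite bformZl [bform g (xi b) w]gC.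
move=> <-; rewrite /a -[_ (w *m phi)]opprK -!om_flip !opprK.
have E x y : bform g (nphi x y *m phi) w =
    bform g (y *m Dphi x *m phi) w + bform g (Gam x (y *m phi) *m phi) w
    - bform g (Gam x y *m phi *m phi) w.
  by rewrite /nphi !mulmxDl mulNmx !bformDl bformNl.
rewrite -[bform g (nphi u v) _]opprK -om_flip !E /nphi !bformDl !bformNl.
rewrite (Gam_sym (v *m phi)) (Gam_sym v u) (Gam_sym (v *m phi) u).
rewrite (Gam_sym v (u *m phi)).
ring.
Qed.

Lemma nabla_xi_pointwise b u : nxi b u = - (u *m phi).
Proof.
apply: (bform_eq gpos) => v; rewrite bformNl om_flip opprK.
have gl w : linear_for *%R ((bform g)^~ w) := bform_linearl g w.
have ar x y : linear_for *%R (a x y).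
  by move=> k p q; rewrite /a bformDr bformZr.
have := nabla_xi_tensor (phi := fun v => v *m phi) gC gl nl nr ar a0 phiphi phixi
  etaphi aN aC axi nN nxiN nij b u v.
exact.
Qed.

Lemma nabla_phi_pointwise u v : nphi u v =
  \sum_b (bform g (u *m phi) (v *m phi) *: xi b + eta b v *: (u *m phi *m phi)).
Proof.
apply: (bform_eq gpos) => w.
have gl w : linear_for *%R ((bform g)^~ w) := bform_linearl g w.
have ar x y : linear_for *%R (a x y).
  by move=> k p q; rewrite /a bformDr bformZr.
have := nabla_phi_tensor (phi := fun v => v *m phi) gC gl nl nr ar a0 phiphi
  phixi etaphi skew aN aC aphi axi nN nxiN nij u v w.
rewrite /a => ->; rewrite bform_suml mulr_suml mulr_suml -sumrB.
apply: eq_bigr => b _; rewrite bformDl !bformZl (om_flip (u *m phi)) mulrN.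
by rewrite [in LHS]mulrC /eta (gC w).
Qed.

End Pointwise.

(** * The covariant derivatives of xi and phi on an S-manifold *)

Section DeriveProducts.
Variables (R : realType) (n : nat) (V : normedModType R) (U : set V) (x w : V).

Lemma differentiable_bform (G : V -> 'M[R]_n) (f h : V -> 'rV[R]_n) :
  differentiable G x -> differentiable f x -> differentiable h x ->
  differentiable (fun y => bform (G y) (f y) (h y)) x.
Proof.
move=> dG df dh; have dT := differentiable_trmx dh.
apply: (@differentiable_entry _ _ _ _ (fun y => f y *m G y *m (h y)^T)).
by apply: differentiable_mulmx => //; exact: differentiable_mulmx.
Qed.

Lemma derive_mulmxl m p (v : 'M[R]_(m, n)) (A : V -> 'M[R]_(n, p)) :
  differentiable A x ->
  differentiable (fun y => v *m A y) x /\
  'D_w (fun y => v *m A y) x = v *m 'D_w A x.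
Proof.
move=> dA; have dv := differentiable_cst v x; split.
  exact: (differentiable_mulmx dv dA).
by rewrite (derive_mulmx w dv dA) derive_cst mul0mx add0r.
Qed.

Lemma derive_scale (f : V -> R) (h : V -> 'rV[R]_n) :
  differentiable f x -> differentiable h x ->
  differentiable (fun y => f y *: h y) x /\
  'D_w (fun y => f y *: h y) x = 'D_w f x *: h x + f x *: 'D_w h x.
Proof.
move=> df dh.
have E : (fun y => f y *: h y) = (fun y => (f y *: 1%:M : 'M[R]_1) *m h y).
  by apply/funext => y; rewrite -scalemxAl mul1mx.
have dZ : differentiable (fun y => f y *: (1%:M : 'M[R]_1)) x.
  exact: differentiableZl.
rewrite E; split; first exact: differentiable_mulmx.
rewrite (derive_mulmx w dZ dh) (deriveE w dZ) diffZl // -(deriveE w df).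
by rewrite -!scalemxAl !mul1mx.
Qed.

Lemma derive_ZB (a : R) (f1 f2 : V -> R) :
  differentiable f1 x -> differentiable f2 x ->
  'D_w (fun y => a * (f1 y - f2 y)) x = a * ('D_w f1 x - 'D_w f2 x).
Proof.
move=> d1 d2; have dB := derivableB (diff_derivable d1) (diff_derivable d2).
have := deriveZ a (dB w).
by rewrite deriveB //; exact: diff_derivable.
Qed.

Lemma derive_locally_cst (W : normedModType R) (f : V -> W) c :
  open U -> U x -> (forall y, U y -> f y = c) -> 'D_w f x = 0.
Proof.
move=> oU Ux fc; rewrite -(derive_cst c x w); apply: near_eq_derive.
exact: eq_on_open oU fc _ Ux.
Qed.

Lemma derive_eq_on (W : normedModType R) (f h : V -> W) :
  open U -> U x -> (forall y, U y -> f y = h y) -> 'D_w f x = 'D_w h x.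
Proof.
by move=> oU Ux fh; apply: near_eq_derive; exact: eq_on_open oU fh _ Ux.
Qed.

End DeriveProducts.

(** For constant u and v the bracket [u, v] vanishes and the other brackets only differentiate A, so
    normality becomes a first-order relation on A. *)
Lemma nijenhuis_cst (R : realType) n (A : 'rV[R]_n -> 'M[R]_n) x u v :
  differentiable A x ->
  nijenhuis A (fun=> u) (fun=> v) x =
  v *m 'D_(u *m A x) A x - u *m 'D_(v *m A x) A x
  + u *m 'D_v A x *m A x - v *m 'D_u A x *m A x.
Proof.
move=> dA.
have L w p : 'D_w (fun y => p *m A y) x = p *m 'D_w A x.
  exact: (derive_mulmxl w p dA).2.
have C w p : 'D_w (fun=> p : 'rV[R]_n) x = 0 by exact: derive_cst.
have E0 : lie_bracket (fun=> u) (fun=> v) x = 0.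
  by rewrite /lie_bracket !C subrr.
have E1 : lie_bracket (fun y => u *m A y) (fun y => v *m A y) x =
    v *m 'D_(u *m A x) A x - u *m 'D_(v *m A x) A x.
  by rewrite /lie_bracket !L.
have E2 : lie_bracket (fun y => u *m A y) (fun=> v) x = - (u *m 'D_v A x).
  by rewrite /lie_bracket L C sub0r.
have E3 : lie_bracket (fun=> u) (fun y => v *m A y) x = v *m 'D_u A x.
  by rewrite /lie_bracket L C subr0.
rewrite /nijenhuis E0 E1 E2 E3.
by rewrite !mul0mx add0r mulNmx opprK.
Qed.

Section StructureEquations.
Variables (R : realType) (m s : nat) (M : framed_manifold R m s).
Hypothesis hs : (0 < s)%N.
Hypothesis hM : S_manifold M.
Variable i : Defs.index M.
Let U := cimg (at_chart i).
Let g := Defs.met M i.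
Let f := Defs.phi M i.
Let h b := Defs.eta M b i.
Let z b := Defs.xi M b i.
Local Notation vec := 'rV[R]_(2 * m + s).

Let oU : open U. Proof. exact: cimg_open. Qed.

Let dg y : U y -> differentiable g y.
Proof. by have [sg _ _ _] := met_riemannian M; exact: smooth_on_diff (sg i). Qed.
Let df y : U y -> differentiable f y.
Proof. by have [sf _] := phi_endo M; exact: smooth_on_diff (sf i). Qed.
Let dz b y : U y -> differentiable (z b) y.
Proof. by have [sz _] := xi_field M b; exact: smooth_on_diff (sz i). Qed.
Let gC y : U y -> forall u v, bform (g y) u v = bform (g y) v u.
Proof. by have [_ _ gs _] := met_riemannian M; exact: gs. Qed.
Let gpos y : U y -> forall v, v != 0 -> 0 < bform (g y) v v.
Proof. by have [_ _ _ gp] := met_riemannian M; exact: gp. Qed.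

Lemma eta_bform b y v : U y -> pairing (h b y) v = bform (g y) v (z b y).
Proof. by move=> Uy; exact: eta_met. Qed.

Lemma bform_phi_xi b y v : U y -> bform (g y) (v *m f y) (z b y) = 0.
Proof. by move=> Uy; rewrite -eta_bform //; exact: eta_phi. Qed.

Lemma phi_phi y v : U y ->
  v *m f y *m f y = - v + \sum_b bform (g y) v (z b y) *: z b y.
Proof.
move=> Uy; rewrite phi_sqr //; congr (_ + _); apply: eq_bigr => b _.
by rewrite -/(h b y) eta_bform.
Qed.

(** This is [met_phi] at (u, phi v): phi^2 v is - v up to multiples of the xi, and these are
    orthogonal to phi u. *)
Lemma phi_skew y u v : U y ->
  bform (g y) u (v *m f y) = - bform (g y) v (u *m f y).
Proof.
move=> Uy; have := met_phi Uy u (v *m f y).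
rewrite -/(g y) -/(f y) big1 ?subr0 => [<-|b _]; last by rewrite eta_phi // mulr0.
rewrite phi_phi // bformDr bformNr bform_sumr big1 ?addr0 => [|b _].
  by rewrite (gC Uy v).
by rewrite bformZr bform_phi_xi // mulr0.
Qed.

Let om u v y := bform (g y) u (v *m f y).

Let deta_om b u v y : U y ->
  2^-1 * ('D_u (fun p => pairing (h b p) v) y - 'D_v (fun p => pairing (h b p) u) y)
  = om u v y.
Proof.
move=> Uy.
have su w : smooth_on U (fun=> w : vec) by exact: smooth_on_cst.
have [_ E] := deta_met b (su u) (su v) Uy.
rewrite /om -E /ext_deriv /lie_bracket !derive_cst subrr.
by rewrite [pairing _ 0]big1 ?subr0 // => k _; rewrite mxE mulr0.
Qed.

Variable x : vec.
Hypothesis Ux : U x.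

Let d_om_at w u v : differentiable (om u v) x /\
  'D_w (om u v) x = bform ('D_w g x) u (v *m f x) + bform (g x) u (v *m 'D_w f x).
Proof.
have [dvf Evf] := derive_mulmxl w v (df Ux); have du := differentiable_cst u x.
split; first exact: (differentiable_bform (dg Ux) du dvf).
by rewrite (derive_bform w (dg Ux) du dvf) Evf derive_cst bform0l addr0.
Qed.

Let d_eta_at w b v : differentiable (fun y => bform (g y) v (z b y)) x /\
  'D_w (fun y => bform (g y) v (z b y)) x =
  bform ('D_w g x) v (z b x) + bform (g x) v ('D_w (z b) x).
Proof.
have dv := differentiable_cst v x.
split; first exact: (differentiable_bform (dg Ux) dv (dz b Ux)).
by rewrite (derive_bform w (dg Ux) dv (dz b Ux)) derive_cst bform0l addr0.
Qed.

Let d_skew w u v :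
  bform ('D_w g x) u (v *m f x) + bform (g x) u (v *m 'D_w f x) +
  (bform ('D_w g x) v (u *m f x) + bform (g x) v (u *m 'D_w f x)) = 0.
Proof.
have [d1 <-] := d_om_at w u v; have [d2 <-] := d_om_at w v u.
rewrite -(deriveD (diff_derivable d1) (diff_derivable d2)).
apply: (derive_locally_cst (c := 0) w oU Ux) => y Uy.
by rewrite /= fctE /om phi_skew // addNr.
Qed.

Let d_phiphi w v : v *m 'D_w f x *m f x + v *m f x *m 'D_w f x =
  \sum_b ((bform ('D_w g x) v (z b x) + bform (g x) v ('D_w (z b) x)) *: z b x
          + bform (g x) v (z b x) *: 'D_w (z b) x).
Proof.
have [dvf Evf] := derive_mulmxl w v (df Ux).
rewrite -Evf -(derive_mulmx w dvf (df Ux)).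
rewrite (derive_eq_on w oU Ux (fun y => @phi_phi y v)).
pose F b y := bform (g y) v (z b y) *: z b y.
have dF b := derive_scale w (d_eta_at w b v).1 (dz b Ux).
have E : (fun y => - v + \sum_b bform (g y) v (z b y) *: z b y) =
    cst (- v) + \sum_b F b.
  by apply/funext => y; rewrite !fctE fct_sumE.
rewrite E deriveD; last 2 first.
- exact: derivable_cst.
- by apply: derivable_sum => b; apply/diff_derivable; case: (dF b).
rewrite derive_cst add0r derive_sum; last first.
  by move=> b; apply/diff_derivable; case: (dF b).
by apply: eq_bigr => b _; rewrite (dF b).2 (d_eta_at w b v).2.
Qed.

Let d_phixi w b : 'D_w (z b) x *m f x + z b x *m 'D_w f x = 0.
Proof.
rewrite -(derive_mulmx w (dz b Ux) (df Ux)).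
apply: (derive_locally_cst w oU Ux) => y Uy; exact: phi_xi.
Qed.

Let d_pairing w b v : 'D_w (fun y => pairing (h b y) v) x =
  bform ('D_w g x) v (z b x) + bform (g x) v ('D_w (z b) x).
Proof.
rewrite -(d_eta_at w b v).2; apply: (derive_eq_on w oU Ux) => y.
exact: eta_bform.
Qed.

Let d_eta b u v :
  bform ('D_u g x) v (z b x) + bform (g x) v ('D_u (z b) x)
  - (bform ('D_v g x) u (z b x) + bform (g x) u ('D_v (z b) x)) =
  2 * bform (g x) u (v *m f x).
Proof.
rewrite -/(om u v x) -(deta_om b u v Ux) !d_pairing.
by rewrite mulrA divff ?mul1r.
Qed.

Let d_etaxi w b c :
  bform ('D_w g x) (z b x) (z c x) + bform (g x) ('D_w (z b) x) (z c x)
  + bform (g x) (z b x) ('D_w (z c) x) = 0.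
Proof.
rewrite -(derive_bform w (dg Ux) (dz b Ux) (dz c Ux)).
apply: (derive_locally_cst w oU Ux) => y Uy.
rewrite -eta_bform //; exact: eta_xi.
Qed.

Let d_om_cyc u v w : 'D_u (om v w) x + 'D_v (om w u) x + 'D_w (om u v) x = 0.
Proof.
(* Any one eta^b serves, since each has differential Omega; 0 < s provides the index. *)
pose b := Ordinal hs; pose H p := fun y => pairing (h b y) p.
have H2 p : Ck_on 2 U (H p).
  have [sh _] := eta_form M b.
  apply: (Ck_on_eq oU _ (Ck_on_entry 0 0 oU (smooth_on_mulmx oU (sh i)
    (fun k => Ck_on_cst k U (p^T)) 2))) => y _.
  by rewrite /H pairingE.
have dH p r : differentiable ('D_r (H p)) x.
  by have [_ /(_ r)[ddf _]] := H2 p; exact: ddf.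
(* F t p r is D_t D_p of eta^b(r). Its symmetry in t and p makes the six terms of the cyclic sum
   cancel in pairs. *)
have [F FD FC] : exists2 F : vec -> vec -> vec -> R,
    forall t p r, 'D_t (om p r) x = 2^-1 * (F t p r - F t r p) &
    forall t p r, F t p r = F p t r.
  exists (fun t p r => 'D_t ('D_p (H r)) x) => t p r.
    rewrite -(derive_ZB t 2^-1 (dH r p) (dH p r)).
    by apply: (derive_eq_on t oU Ux) => y Uy; rewrite -(deta_om b).
  exact: (derive_comm (H2 r) oU p t Ux).
rewrite !FD (FC v u) (FC w u) (FC w v); ring.
Qed.

Let d_om u v w :
  bform ('D_u g x) v (w *m f x) + bform (g x) v (w *m 'D_u f x) +
  (bform ('D_v g x) w (u *m f x) + bform (g x) w (u *m 'D_v f x)) +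
  (bform ('D_w g x) u (v *m f x) + bform (g x) u (v *m 'D_w f x)) = 0.
Proof.
by rewrite -(d_om_at u v w).2 -(d_om_at v w u).2 -(d_om_at w u v).2 d_om_cyc.
Qed.

Let normal u v :
  v *m 'D_(u *m f x) f x - u *m 'D_(v *m f x) f x
  + u *m 'D_v f x *m f x - v *m 'D_u f x *m f x =
  - 2 *: \sum_b bform (g x) u (v *m f x) *: z b x.
Proof.
have su w : smooth_on U (fun=> w : vec) by exact: smooth_on_cst.
have E b : ext_deriv (h b) (fun=> u) (fun=> v) x = bform (g x) u (v *m f x).
  by have [_ ->] := deta_met b (su u) (su v) Ux.
rewrite -(nijenhuis_cst u v (df Ux)) (hM (su u) (su v) Ux).
by congr (_ *: _); apply: eq_bigr => b _; congr (_ *: _); exact: E.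
Qed.

Lemma nabla_xi b u : 'D_u (z b) x + christoffel g x u (z b x) = - (u *m f x).
Proof.
have Gs := christoffel_sym oU dg gC gpos Ux.
have Gl := christoffel_linear dg gpos Ux.
have Gc := metric_compat oU dg gC gpos Ux.
have pp v := phi_phi v Ux.
have pz b' := phi_xi Ux b'.
have ep b' v := bform_phi_xi b' v Ux.
have sk u' v := phi_skew u' v Ux.
have fl := derive_linear (df Ux).
have zl b' := derive_linear (dz b' Ux).
exact: (nabla_xi_pointwise (gC Ux) (gpos Ux) pp pz ep sk Gs Gl Gc fl zl
  d_skew d_phixi d_eta d_etaxi d_om normal).
Qed.

Lemma nabla_phi u v :
  v *m 'D_u f x + christoffel g x u (v *m f x) - christoffel g x u v *m f x =
  \sum_b (bform (g x) (u *m f x) (v *m f x) *: z b x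
          + bform (g x) v (z b x) *: (u *m f x *m f x)).
Proof.
have Gs := christoffel_sym oU dg gC gpos Ux.
have Gl := christoffel_linear dg gpos Ux.
have Gc := metric_compat oU dg gC gpos Ux.
have pp v' := phi_phi v' Ux.
have pz b' := phi_xi Ux b'.
have ep b' v' := bform_phi_xi b' v' Ux.
have sk u' v' := phi_skew u' v' Ux.
have fl := derive_linear (df Ux).
have zl b' := derive_linear (dz b' Ux).
exact: (nabla_phi_pointwise (gC Ux) (gpos Ux) pp pz ep sk Gs Gl Gc fl zl
  d_skew d_phiphi d_phixi d_eta d_etaxi d_om normal).
Qed.

End StructureEquations.

(** * Fields along a curve *)

Section FieldsAlong.
Variables (R : realType) (n : nat) (M : manifold R n) (I : set R).
Variables (gamma : R -> M).
Hypothesis oI : open I.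
Hypothesis hgamma : smooth_curve I gamma.

(** An open set of times, so an identity between components in the chart i that holds on it may be
    differentiated. *)
Definition chart_times (i : Defs.index M) : set R :=
  I `&` gamma @^-1` cdom (at_chart i).

Local Notation J := chart_times.

Lemma open_chart_times i : open (J i).
Proof.
rewrite openE => t [It Ct]; apply: filterI.
  exact: open_nbhs_nbhs.
have [cg _] := hgamma; apply: (cg t It).
by apply: open_nbhs_nbhs; split=> //; exact: cdom_open.
Qed.

Arguments open_chart_times : clear implicits.

Let c i t := cfun (at_chart i) (gamma t).

Lemma chart_times_cimg i t : J i t -> cimg (at_chart i) (c i t).
Proof. by move=> [_ Ct]; exists (gamma t). Qed.

Lemma smooth_coordinates i : smooth_on (J i) (c i).
Proof. by have [_ sg] := hgamma; exact: sg. Qed.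

Lemma velocityE i : velocity gamma i = 'D_(1 : R) (c i).
Proof. by apply/funext => t; rewrite /velocity derive1E. Qed.

Lemma chart_times_overlap i j t : J i t -> J j t ->
  overlap (at_chart i) (at_chart j) (c i t).
Proof.
move=> Ji [_ Cj]; split; first exact: chart_times_cimg.
by rewrite /c cfunK //; case: Ji.
Qed.

Lemma transition_coordinates i j t : J i t ->
  transition (at_chart i) (at_chart j) (c i t) = c j t.
Proof. by move=> [_ Ci]; rewrite /transition /c cfunK. Qed.

Lemma differentiable_transition i j t : J i t -> J j t ->
  differentiable (transition (at_chart i) (at_chart j)) (c i t).
Proof.
move=> Ji Jj.
exact: smooth_on_diff (chart_compat i j) (chart_times_overlap Ji Jj).
Qed.

Lemma pushfwd_linear i j t : J i t -> J j t -> linear (pushfwd i j (c i t)).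
Proof.
by move=> Ji Jj; exact: (derive_linear (differentiable_transition Ji Jj)).
Qed.

Lemma field_along_velocity : field_along I gamma (velocity gamma).
Proof.
split=> [i|i j t It Ci Cj].
  by rewrite velocityE; exact: smooth_on_derive (smooth_coordinates i).
have Ji : J i t by []. have Jj : J j t by [].
have dc := smooth_on_diff (smooth_coordinates i) Ji.
rewrite !velocityE /pushfwd.
rewrite -(derive_comp (1 : R) dc (differentiable_transition Ji Jj)).
have E y : J i y -> c j y = transition (at_chart i) (at_chart j) (c i y).
  by move=> Jy; rewrite transition_coordinates.
exact: (derive_eq_on (1 : R) (open_chart_times i) Ji E).
Qed.

Lemma field_alongZ a (v : curve_components M) : field_along I gamma v ->
  field_along I gamma (fun i t => a *: v i t).
Proof.
move=> [sv tv]; split=> [i|i j t It Ci Cj].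
  exact: smooth_onZ (open_chart_times i) (sv i).
rewrite (tv i j t It Ci Cj) (linear_scaling (@pushfwd_linear i j t _ _)) //.
Qed.

Lemma field_alongD (v w : curve_components M) : field_along I gamma v ->
  field_along I gamma w -> field_along I gamma (fun i t => v i t + w i t).
Proof.
move=> [sv tv] [sw tw]; split=> [i|i j t It Ci Cj].
  exact: smooth_onD (open_chart_times i) (sv i) (sw i).
rewrite (tv i j t It Ci Cj) (tw i j t It Ci Cj).
by rewrite (linear_addition (@pushfwd_linear i j t _ _)).
Qed.

Lemma smooth_restrict k l (X : components M 'M[R]_(k, l)) i :
  smooth_components X -> smooth_on (J i) (restrict_along gamma X i).
Proof.
move=> sX; apply: (smooth_on_comp (open_chart_times i) _ _
  (smooth_coordinates i) (sX i)); first exact: cimg_open.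
exact: chart_times_cimg.
Qed.

Lemma field_along_endo (A : components M 'M[R]_n) (v : curve_components M) :
  endo_field A -> field_along I gamma v ->
  field_along I gamma (fun i t => v i t *m restrict_along gamma A i t).
Proof.
move=> [sA tA] [sv tv]; split=> [i|i j t It Ci Cj].
  exact: (smooth_on_mulmx (open_chart_times i) (sv i) (@smooth_restrict _ _ A i sA)).
have Ji : J i t by []. have Jj : J j t by [].
have := tA i j _ (chart_times_overlap Ji Jj) (v i t).
by rewrite transition_coordinates // (tv i j t It Ci Cj) => <-.
Qed.

Lemma field_along_restrict k (X : 'I_k -> components M 'rV[R]_n) :
  (forall b, vector_field (X b)) ->
  field_along I gamma (restrict_along gamma (fun i x => \sum_b X b i x)).
Proof.
move=> hX; split=> [i|i j t It Ci Cj].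
  have sXb b : smooth_on (J i) (restrict_along gamma (X b) i).
    by have [sX _] := hX b; exact: (@smooth_restrict 1 n (X b) i sX).
  exact: (smooth_on_sum (open_chart_times i) sXb).
have Ji : J i t by []. have Jj : J j t by [].
rewrite /restrict_along (linear_bigsum (pushfwd_linear Ji Jj)).
apply: eq_bigr => b _; have [_ tX] := hX b.
by have := tX i j _ (chart_times_overlap Ji Jj); rewrite transition_coordinates.
Qed.

Lemma differentiable_field (v : curve_components M) i t :
  field_along I gamma v -> J i t -> differentiable (v i) t.
Proof. by move=> [sv _]; exact: smooth_on_diff (sv i). Qed.

(** The chain rule through which the chart identities for nabla_T xi and nabla_T phi yield covariant
    derivatives along the curve. *)
Lemma derive_restrict k l (X : components M 'M[R]_(k, l)) i t :
  smooth_components X -> J i t ->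
  differentiable (restrict_along gamma X i) t /\
  'D_(1 : R) (restrict_along gamma X i) t = 'D_(velocity gamma i t) (X i) (c i t).
Proof.
move=> sX Ji; split; first exact: (smooth_on_diff (@smooth_restrict k l X i sX) Ji).
rewrite velocityE.
rewrite -(derive_comp (1 : R) (smooth_on_diff (smooth_coordinates i) Ji)) //.
exact: smooth_on_diff (sX i) (chart_times_cimg Ji).
Qed.

Section CovariantDerivative.
Variable g : components M 'M[R]_n.
Hypothesis hg : riemannian_metric g.

Lemma christoffel_linear_along i t u : J i t ->
  linear (christoffel (g i) (c i t) u).
Proof.
have [sg _ _ gp] := hg; move=> Ji.
apply: (christoffel_linear (U := cimg (at_chart i))).
- by move=> x; exact: smooth_on_diff (sg i).
- exact: gp.
- exact: chart_times_cimg.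
Qed.

Lemma cov_derivE (v : curve_components M) i t : cov_deriv g gamma v i t =
  'D_(1 : R) (v i) t + christoffel (g i) (c i t) (velocity gamma i t) (v i t).
Proof. by rewrite /cov_deriv derive1E. Qed.

Lemma cov_derivZ a (v : curve_components M) i t :
  field_along I gamma v -> J i t ->
  cov_deriv g gamma (fun i t => a *: v i t) i t = a *: cov_deriv g gamma v i t.
Proof.
move=> hv Ji; have dv := diff_derivable (v := 1 : R) (differentiable_field hv Ji).
rewrite !cov_derivE (linear_scaling (christoffel_linear_along _ Ji)).
by rewrite scalerDr; congr (_ + _); exact: (deriveZ a dv).
Qed.

Lemma cov_derivD (v w : curve_components M) i t :
  field_along I gamma v -> field_along I gamma w -> J i t ->
  cov_deriv g gamma (fun i t => v i t + w i t) i t =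
  cov_deriv g gamma v i t + cov_deriv g gamma w i t.
Proof.
move=> hv hw Ji.
have dv := diff_derivable (v := 1 : R) (differentiable_field hv Ji).
have dw := diff_derivable (v := 1 : R) (differentiable_field hw Ji).
rewrite !cov_derivE (linear_addition (christoffel_linear_along _ Ji)).
by rewrite addrACA; congr (_ + _); exact: (deriveD dv dw).
Qed.

End CovariantDerivative.

End FieldsAlong.

(** * Slant magnetic curves *)

Section SlantCurves.
Variables (R : realType) (m s : nat) (hs : (0 < s)%N).
Variables (M : framed_manifold R m s) (hM : S_manifold M).
Variables (I : set R) (oI : open I) (gamma : R -> M).
Hypothesis hgamma : smooth_curve I gamma.
Hypothesis hunit : unit_speed (met M) I gamma.
Let S := s%:R : R.
Let T := velocity gamma.
Let F := phiT gamma : curve_components M.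
Let X := restrict_along gamma (xi_sum M).
Let cov := cov_deriv (met M) gamma.
Local Notation J := (chart_times I gamma).
Local Notation ip i t := (bform (restrict_along gamma (met M) i t)).

Let coord_cimg i t : J i t -> cimg (at_chart i) (cfun (at_chart i) (gamma t)).
Proof. exact: chart_times_cimg. Qed.

Lemma field_along_T : field_along I gamma T.
Proof. exact: field_along_velocity oI hgamma. Qed.

Lemma field_along_phiT : field_along I gamma F.
Proof. exact (field_along_endo oI hgamma (phi_endo M) field_along_T). Qed.

Lemma field_along_xibar : field_along I gamma X.
Proof. exact (field_along_restrict oI hgamma (xi_field M)). Qed.

Lemma ip_sym i t u v : J i t -> ip i t u v = ip i t v u.
Proof.
by move=> /coord_cimg Ux; have [_ _ gs _] := met_riemannian M; exact: gs.
Qed.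

Lemma ip_T i t : J i t -> ip i t (T i t) (T i t) = 1.
Proof. by move=> [It Ct]; exact: hunit. Qed.

Lemma ip_T_phiT i t : J i t -> ip i t (T i t) (F i t) = 0.
Proof.
move=> /coord_cimg Ux; have := phi_skew (T i t) (T i t) Ux; rewrite -/T.
rewrite /F /phiT /restrict_along -/T; lra.
Qed.

Lemma ip_phiT_xibar i t : J i t -> ip i t (F i t) (X i t) = 0.
Proof.
move=> /coord_cimg Ux; rewrite /X /restrict_along /xi_sum bform_sumr.
by rewrite big1 // => b _; exact: (bform_phi_xi b (T i t) Ux).
Qed.

Lemma ip_xibar i t : J i t -> ip i t (X i t) (X i t) = S.
Proof.
move=> /coord_cimg Ux; rewrite /X /restrict_along /xi_sum bform_sumr.
rewrite (eq_bigr (fun=> 1)) ?sumr_const ?card_ord // => b _.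
rewrite bform_suml (bigD1 b) //= big1 ?addr0 => [|a /negPf ab];
  by rewrite -eta_met // eta_xi // ?eqxx // eq_sym ab.
Qed.

Lemma cov_deriv_xibar i t : J i t -> cov X i t = - S *: F i t.
Proof.
move=> Jt; have Ux := coord_cimg Jt.
have dx b := derive_restrict oI hgamma (xi_field M b).1 Jt.
rewrite /cov cov_derivE.
have -> : X i = \sum_b restrict_along gamma (xi M b) i.
  by apply/funext => y; rewrite fct_sumE.
rewrite derive_sum; last by move=> b; apply/diff_derivable; case: (dx b).
rewrite fct_sumE.
rewrite (linear_bigsum (christoffel_linear_along (met_riemannian M) _ Jt)).
rewrite -big_split (eq_bigr (fun=> - F i t)) => [|b _].
  by rewrite sumr_const card_ord scaleNr scaler_nat mulNrn.
by rewrite /= (dx b).2; exact: (nabla_xi hs hM Ux b (T i t)).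
Qed.

Section Slant.
Variable c : R.
Hypothesis slant_c : along I gamma (fun i t => forall a : 'I_s,
  pairing (restrict_along gamma (eta M a) i t) (T i t) = c).

Lemma ip_T_xi i t b : J i t -> ip i t (T i t) (restrict_along gamma (xi M b) i t) = c.
Proof.
move=> Jt; have Ux := coord_cimg Jt; have [It Ct] := Jt.
by rewrite -(slant_c It Ct b) /restrict_along eta_met.
Qed.

Lemma ip_T_xibar i t : J i t -> ip i t (T i t) (X i t) = S * c.
Proof.
move=> Jt; rewrite /X /restrict_along /xi_sum bform_sumr.
rewrite (eq_bigr (fun=> c)) => [|b _]; last exact: ip_T_xi.
by rewrite sumr_const card_ord mulr_natl.
Qed.

Lemma ip_phiT i t : J i t -> ip i t (F i t) (F i t) = 1 - S * c ^+ 2.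
Proof.
move=> Jt; have Ux := coord_cimg Jt; have [It Ct] := Jt.
rewrite /F /phiT {1}/restrict_along met_phi // ip_T //; congr (_ - _).
rewrite (eq_bigr (fun=> c * c)) => [|b _]; last by rewrite (slant_c It Ct b).
by rewrite sumr_const card_ord mulr_natl.
Qed.

Lemma phi_phiT i t : J i t ->
  F i t *m restrict_along gamma (phi M) i t = - T i t + c *: X i t.
Proof.
move=> Jt; have Ux := coord_cimg Jt.
rewrite (phi_phi (T i t) Ux) scaler_sumr; congr (_ + _).
by apply: eq_bigr => b _; rewrite (ip_T_xi b Jt).
Qed.

(** Leibniz: phi (nabla_T T) plus (nabla_T phi) T. The second term is [nabla_phi] at (T, T), where
    |phi T|^2 = 1 - S c^2, eta^a(T) = c and phi^2 T = - T + c xibar. *)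
Lemma cov_deriv_phiT i t : J i t -> cov F i t =
  cov T i t *m restrict_along gamma (phi M) i t
  + ((1 - S * c ^+ 2) *: X i t + (S * c) *: (- T i t + c *: X i t)).
Proof.
move=> Jt; have Ux := coord_cimg Jt.
have [dp Ep] := derive_restrict oI hgamma (phi_endo M).1 Jt.
have dT := differentiable_field field_along_T Jt.
have EF : 'D_(1 : R) (F i) t = 'D_(1 : R) (T i) t *m restrict_along gamma (phi M) i t
    + T i t *m 'D_(1 : R) (restrict_along gamma (phi M) i) t.
  exact: (derive_mulmx (1 : R) dT dp).
rewrite /cov !cov_derivE EF Ep mulmxDl -!addrA; congr (_ + _).
have := nabla_phi hs hM Ux (T i t) (T i t).
move=> /(canRL (subrK _)) ->; rewrite addrC; congr (_ + _).
rewrite big_split /= -scaler_sumr; congr (_ + _).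
  by congr (_ *: _); exact: (ip_phiT Jt).
rewrite -(phi_phiT Jt) (eq_bigr (fun=> c *: (F i t *m restrict_along gamma (phi M) i t))).
  by rewrite sumr_const card_ord -scaler_nat scalerA.
by move=> b _; congr (_ *: _); exact: (ip_T_xi b Jt).
Qed.

(** The quantity is |phi T|^2 at any point of the curve. *)
Lemma cos_bound : I !=set0 -> 0 <= 1 - S * c ^+ 2.
Proof.
move=> [t It]; have [i Ci] := chart_cover (gamma t).
have Jt : J i t by [].
rewrite -(ip_phiT Jt); have [->|F0] := eqVneq (F i t) 0.
  by rewrite bform0l.
by have [_ _ _ gp] := met_riemannian M; apply/ltW/gp => //; exact: coord_cimg.
Qed.

Lemma integral_of_extremal_angle : 1 - S * c ^+ 2 = 0 -> forall i t, J i t ->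
  F i t = 0 /\ T i t = c *: X i t.
Proof.
move=> E i t Jt; have F0 : F i t = 0.
  apply/eqP/negPn/negP => F0; have := ip_phiT Jt; rewrite E => Z.
  have [_ _ _ gp] := met_riemannian M.
  by have := gp i _ (coord_cimg Jt) _ F0; rewrite [bform _ _ _]Z ltxx.
split=> //; have := phi_phiT Jt; rewrite F0 mul0mx => /esym/eqP.
by rewrite addrC subr_eq0 => /eqP.
Qed.

Section Magnetic.
Variable q : R.
Hypothesis magnetic_q : along I gamma (fun i t => cov T i t = - q *: F i t).

Let cov_T i t : J i t -> cov T i t = - q *: F i t.
Proof. by move=> [It Ct]; exact: magnetic_q. Qed.

Let cov_deriv_phiT_magnetic i t : J i t ->
  cov F i t = (1 - q * c) *: X i t + (q - S * c) *: T i t.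
Proof.
move=> Jt; rewrite cov_deriv_phiT // cov_T // -scalemxAl phi_phiT //.
by apply/rowP => j; rewrite !mxE; ring.
Qed.

(** The scalar hypotheses compare coefficients in nabla_T T, in nabla_T v_2 and in |v_2|^2 = 1. The
    condition q c = 1 removes the xibar component of nabla_T (phi T), so the frame closes after two
    vectors. *)
Lemma magnetic_circle (a2 k1 : R) : 0 < k1 -> q * c = 1 -> - q = k1 * a2 ->
  a2 * (q - S * c) = - k1 -> a2 ^+ 2 * (1 - S * c ^+ 2) = 1 ->
  circle (met M) I gamma T (fun i t => a2 *: F i t) k1.
Proof.
move=> k10 qc E1 E2 E3; split; [by []|by []| | |].
- move=> [|[|a]] la.
  + exact: field_along_T.
  + exact: (field_alongZ oI hgamma a2 field_along_phiT).
  + discriminate la.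
- move=> i t It Ct; have Jt : J i t by [].
  case=> [|[|//]] [|[|//]] _ _ /=; rewrite ?bformZl ?bformZr.
  + exact: ip_T.
  + by rewrite ip_T_phiT // mulr0.
  + by rewrite ip_sym // ip_T_phiT // mulr0.
  + by rewrite ip_phiT // mulrA -expr2.
- split=> [[|//] _ //|i t It Ct]; have Jt : J i t by [].
  case=> [|[|//]] _ /=; rewrite ?scale0r ?scaler0 ?add0r ?addr0.
  + by rewrite -/cov cov_T // scalerA -E1.
  + rewrite (cov_derivZ (met_riemannian M) a2 field_along_phiT Jt).
    rewrite -/cov cov_deriv_phiT_magnetic // qc subrr scale0r add0r.
    by rewrite scalerA E2 scaleNr.
Qed.

(** xibar - S c T is the part of xibar orthogonal to T, because g(T, xibar) = S c; its squared norm
    is S (1 - S c^2). Each scalar equation is one coefficient of a Frenet equation or the norm of a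
    frame vector. *)
Lemma magnetic_helix (a2 a3 k1 k2 : R) : 0 < k1 -> 0 < k2 ->
  - q = k1 * a2 -> a2 * (1 - q * c) = k2 * a3 ->
  a2 * (q - S * c) = - k1 - k2 * a3 * (S * c) ->
  a3 * S * (1 - q * c) = k2 * a2 ->
  a2 ^+ 2 * (1 - S * c ^+ 2) = 1 -> a3 ^+ 2 * (S * (1 - S * c ^+ 2)) = 1 ->
  helix (met M) I gamma T (fun i t => a2 *: F i t)
    (fun i t => a3 *: (- (S * c) *: T i t + X i t)) k1 k2.
Proof.
move=> k10 k20 E1 E2 E3 E4 N2 N3.
have fF := field_alongZ oI hgamma a2 field_along_phiT.
have fT' := field_alongZ oI hgamma (- (S * c)) field_along_T.
have fX' := field_alongD oI hgamma fT' field_along_xibar.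
have fX := field_alongZ oI hgamma a3 fX'.
split; [by []|by []| | |].
- move=> [|[|[|a]]] la.
  + exact: field_along_T.
  + exact: fF.
  + exact: fX.
  + discriminate la.
- move=> i t It Ct; have Jt : J i t by [].
  case=> [|[|[|//]]] [|[|[|//]]] _ _ /=;
    rewrite ?bformZl ?bformZr ?bformDl ?bformDr ?bformZl ?bformZr.
  + exact: ip_T.
  + by rewrite ip_T_phiT // mulr0.
  + by rewrite ip_T // ip_T_xibar //; ring.
  + by rewrite ip_sym // ip_T_phiT // mulr0.
  + by rewrite ip_phiT // mulrA -expr2.
  + by rewrite ip_sym // ip_T_phiT // ip_phiT_xibar //; ring.
  + by rewrite ip_T // ip_sym // ip_T_xibar //; ring.
  + by rewrite ip_T_phiT // ip_sym // ip_phiT_xibar //; ring.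
  + rewrite ip_T // (ip_sym (X i t) (T i t)) // ip_T_xibar // ip_xibar //.
    by rewrite -[RHS]N3; ring.
- split=> [[|[|//]] t _ It //|i t It Ct]; have Jt : J i t by [].
  case=> [|[|[|//]]] _ /=; rewrite ?scale0r ?scaler0 ?add0r ?addr0.
  + by rewrite -/cov cov_T // scalerA -E1.
  + rewrite (cov_derivZ (met_riemannian M) a2 field_along_phiT Jt) -/cov.
    rewrite cov_deriv_phiT_magnetic // scalerDr !scalerA E2 E3.
    move: (X i t) (T i t) => x y.
    by apply/rowP => j; rewrite !mxE; ring.
  + rewrite (cov_derivZ (met_riemannian M) a3 fX' Jt).
    rewrite (cov_derivD (met_riemannian M) fT' field_along_xibar Jt).
    rewrite (cov_derivZ (met_riemannian M) _ field_along_T Jt) -/cov.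
    rewrite cov_T // cov_deriv_xibar //.
    rewrite [k2 *: _]scalerA -E4; move: (F i t) => x.
    by apply/rowP => j; rewrite !mxE; ring.
Qed.

End Magnetic.
End Slant.
End SlantCurves.

Lemma frenet_geodesic (R : realType) (n : nat) (M : manifold R n)
    (g : components M 'M[R]_n) (I : set R) (gamma : R -> M) :
  field_along I gamma (velocity gamma) -> unit_speed g I gamma ->
  along I gamma (fun i t => cov_deriv g gamma (velocity gamma) i t = 0) ->
  geodesic g I gamma.
Proof.
move=> fT uT cT; split; [by []|by []| | |].
- by move=> [|a] la; [exact: fT|discriminate la].
- move=> i t It Ct [|a] [|b] la lb; try discriminate la; try discriminate lb.
  exact: uT.
- split=> [a t la|i t It Ct [|a] la]; [discriminate la| |discriminate la].
  by rewrite /= cT // scaler0 addr0.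
Qed.

(** T is split off, so entry 0 of [vs] is v_2. For a geodesic both lists are empty and the default
    values give nabla_T T = 0. *)
Lemma frenet_cov_velocity (R : realType) (n : nat) (M : manifold R n)
    (g : components M 'M[R]_n) (I : set R) (gamma : R -> M) vs ks :
  frenet g I gamma (velocity gamma :: vs) ks ->
  along I gamma (fun i t => cov_deriv g gamma (velocity gamma) i t =
    nth (fun=> 0) ks 0 t *: nth (fun _ _ => 0) vs 0 i t).
Proof.
move=> [_ _ _ _ [_ H]] i t It Ct.
by have := H i t It Ct 0%N isT; rewrite /= add0r.
Qed.

(** * Scalar identities between curvatures and Frenet coefficients *)

Section CurvatureIdentities.
Variables (R : realType) (S q c : R).
Hypothesis S0 : 0 < S.
Hypothesis q0 : q != 0.
Hypothesis D0 : 0 < 1 - S * c ^+ 2.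
Let rho := Num.sqrt (1 - S * c ^+ 2).
Let w := Num.sqrt S.
(* The coefficient of phi T in v_2; that of xibar - s c T in v_3 is [a3]. *)
Let a2 := - Num.sg q / rho.
Let k1 := `|q| * rho.

Let rho0 : rho != 0. Proof. by rewrite gt_eqF // sqrtr_gt0. Qed.
Let w0 : w != 0. Proof. by rewrite gt_eqF // sqrtr_gt0. Qed.
Let rho2 : rho ^+ 2 = 1 - S * c ^+ 2. Proof. by rewrite sqr_sqrtr // ltW. Qed.
Let w2 : w ^+ 2 = S. Proof. by rewrite sqr_sqrtr // ltW. Qed.
Let sg2 : Num.sg q ^+ 2 = 1. Proof. by rewrite sqr_sg q0. Qed.

Lemma curvature1_gt0 : 0 < k1.
Proof. by rewrite mulr_gt0 ?normr_gt0 // sqrtr_gt0. Qed.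

Lemma curvature1_normal : - q = k1 * a2.
Proof.
rewrite /k1 /a2 normrEsg.
have -> : Num.sg q * q * rho * (- Num.sg q / rho) =
  - (Num.sg q ^+ 2 * q) by field.
by rewrite sg2 mul1r.
Qed.

Lemma normal_unit : a2 ^+ 2 * (1 - S * c ^+ 2) = 1.
Proof.
rewrite -rho2 /a2.
have -> : (- Num.sg q / rho) ^+ 2 * rho ^+ 2 = Num.sg q ^+ 2 by field.
exact: sg2.
Qed.

Lemma normal_circle : q * c = 1 -> a2 * (q - S * c) = - k1.
Proof.
(* Expanding, q rho^2 = q - S c (q c), and q c = 1. *)
move=> qc; have -> : q - S * c = q * rho ^+ 2.
  rewrite rho2; apply/eqP; rewrite -subr_eq0.
  have -> : q - S * c - q * (1 - S * c ^+ 2) = S * c * (q * c - 1) by ring.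
  by rewrite qc subrr mulr0.
rewrite /a2 /k1 normrEsg; field; exact: rho0.
Qed.

Hypothesis e0 : 1 - q * c != 0.
(** The sign that lets a2 (1 - q c) = k2 a3 hold with a positive k2. *)
Let eps := Num.sg (1 - q * c).
Let k2 := w * `|1 - q * c|.
Let a3 := - eps * Num.sg q / (w * rho).

Let eps2 : eps ^+ 2 = 1. Proof. by rewrite sqr_sg e0. Qed.

Lemma curvature2_gt0 : 0 < k2.
Proof. by rewrite mulr_gt0 ?normr_gt0 // sqrtr_gt0. Qed.

Lemma curvature2_binormal : a2 * (1 - q * c) = k2 * a3.
Proof.
rewrite /k2 /a3 /a2 normrEsg -/eps.
have -> : w * (eps * (1 - q * c)) * (- eps * Num.sg q / (w * rho)) =
  eps ^+ 2 * (- Num.sg q / rho * (1 - q * c)) by field; rewrite rho0 w0.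
by rewrite eps2 mul1r.
Qed.

(** In general q - S c = q rho^2 - S c (1 - q c); multiplied by a2, the last term is the T-component
    of kappa_2 v_3. *)
Lemma normal_helix : a2 * (q - S * c) = - k1 - k2 * a3 * (S * c).
Proof.
rewrite -curvature2_binormal /k1 normrEsg.
have -> : Num.sg q * q * rho = Num.sg q / rho * q * rho ^+ 2 by field.
by rewrite rho2 /a2; field.
Qed.

Lemma curvature2_normal : a3 * S * (1 - q * c) = k2 * a2.
Proof.
by rewrite /a3 /k2 /a2 normrEsg -/eps -w2; field; rewrite rho0 w0.
Qed.

Lemma binormal_unit : a3 ^+ 2 * (S * (1 - S * c ^+ 2)) = 1.
Proof.
rewrite -rho2 -w2 /a3.
have -> : (- eps * Num.sg q / (w * rho)) ^+ 2 * (w ^+ 2 * rho ^+ 2) =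
  eps ^+ 2 * Num.sg q ^+ 2 by field; rewrite rho0 w0.
by rewrite eps2 sg2 mulr1.
Qed.

End CurvatureIdentities.

(** * Classification by |phi T|, q c and c *)

Theorem theorem1 (R : realType) (m s : nat) (hs : (0 < s)%N)
    (M : framed_manifold R m s) (hM : S_manifold M)
    (q : R) (hq : q != 0)
    (I : set R) (hIo : open I) (hIi : is_interval I) (hI0 : I !=set0)
    (gamma : R -> M) (hgamma : smooth_curve I gamma)
    (hunit : unit_speed (met M) I gamma) :
  let g := met M in
  let T := velocity gamma in
  let xibar := restrict_along gamma (xi_sum M) in
  let S := s%:R : R in
  (slant I gamma /\ normal_magnetic q I gamma)
  <->
  [\/ (* a *)
      geodesic g I gamma /\
      (integral_curve I gamma
         (fun i x => (Num.sqrt S)^-1 *: xi_sum M i x) \/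
       integral_curve I gamma
         (fun i x => - (Num.sqrt S)^-1 *: xi_sum M i x)),
      (* b *)
      let theta := acos q^-1 in
      [/\ Num.sqrt S < `|q|,
          ~ geodesic g I gamma,
          contact_angle I gamma theta &
          circle g I gamma
            T
            (fun i t => (- Num.sg q / Num.sqrt (1 - S * cos theta ^+ 2))
                        *: phiT gamma i t)
            (Num.sqrt (q ^+ 2 - S))],
      (* c *)
      legendre I gamma /\
      helix g I gamma
        T
        (fun i t => - Num.sg q *: phiT gamma i t)
        (fun i t => (- Num.sg q / Num.sqrt S) *: xibar i t)
        `|q| (Num.sqrt S) |
      (* d *)
      exists theta : R,
      [/\ theta != pi / 2,
          `|cos theta| < (Num.sqrt S)^-1,
          contact_angle I gamma theta &
          let epsilon := Num.sg (1 - q * cos theta) in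
          helix g I gamma
            T
            (fun i t => (- Num.sg q / Num.sqrt (1 - S * cos theta ^+ 2))
                        *: phiT gamma i t)
            (fun i t => (- epsilon * Num.sg q /
                          (Num.sqrt S * Num.sqrt (1 - S * cos theta ^+ 2)))
                        *: (- (S * cos theta) *: T i t + xibar i t))
            (`|q| * Num.sqrt (1 - S * cos theta ^+ 2))
            (Num.sqrt S * `|1 - q * cos theta|)]].
Proof.
move=> g T xibar S.
have S0 : 0 < S by rewrite ltr0n.
have S1 : 1 <= S by rewrite ler1n.
have w0 : 0 < Num.sqrt S by rewrite sqrtr_gt0.
have w2 : Num.sqrt S ^+ 2 = S by rewrite sqr_sqrtr // ltW.
have w1 : 1 <= Num.sqrt S by rewrite -sqrtr1 ler_wsqrtr.
have fT : field_along I gamma T by exact: field_along_velocity.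
split; last first.
  have mag : along I gamma (fun i t => cov_deriv g gamma T i t = - q *: phiT gamma i t) ->
      normal_magnetic q I gamma by move=> H; split.
  (* For c in [-1, 1], arccos c is an angle in [0, pi] with the prescribed cosine. *)
  have sl c : -1 <= c <= 1 -> along I gamma (fun i t => forall a : 'I_s,
      pairing (restrict_along gamma (Defs.eta M a) i t) (T i t) = c) ->
      slant I gamma.
    move=> c1 H; exists (acos c); split; first by rewrite acos_ge0 ?acos_lepi.
    by rewrite acosK.
  have sg2 : Num.sg q * Num.sg q = 1 by rewrite -expr2 sqr_sg hq.
  have qE : `|q| * Num.sg q = q by rewrite mulrC -numEsg.
  case.
  - move=> [geo hint].
    (* Both orientations at once: c is 1 / sqrt S up to sign, and lies in [-1, 1] because S >= 1. *)
    have [c [c1 hc]] : exists c, -1 <= c <= 1 /\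
        along I gamma (fun i t => T i t = c *: xibar i t).
      have w1' : (Num.sqrt S)^-1 <= 1 by rewrite invf_le1.
      have w0' : 0 < (Num.sqrt S)^-1 by rewrite invr_gt0.
      case: hint => H; [exists (Num.sqrt S)^-1|exists (- (Num.sqrt S)^-1)];
        (split; [by apply/andP; split; lra|exact: H]).
    have etaX a i t : I t -> cdom (at_chart i) (gamma t) ->
        pairing (restrict_along gamma (Defs.eta M a) i t) (T i t) = c.
      move=> It Ct; have Ux := chart_times_cimg (conj It Ct).
      rewrite (hc _ _ It Ct) /xibar /restrict_along eta_met // bformZl bform_suml.
      rewrite (bigD1 a) //= big1 ?addr0 => [|b ba].
        by rewrite -eta_met // eta_xi // eqxx mulr1.
      by rewrite -eta_met // eta_xi // eq_sym (negPf ba).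
    split; first by apply: (sl c) => // i t It Ct a; exact: etaX.
    apply: mag => i t It Ct.
    have := frenet_cov_velocity geo It Ct; rewrite /= scaler0 => ->.
    rewrite /phiT -/T (hc _ _ It Ct) -scalemxAl /xibar /restrict_along /xi_sum.
    have Ux := chart_times_cimg (conj It Ct).
    by rewrite mulmx_suml big1 ?scaler0 // => b _; exact: phi_xi.
  - move=> /= [wq _ [_ ang] circ].
    (* |q| > sqrt S >= 1 puts 1 / q in the range on which cos inverts arccos. *)
    have q1 : -1 <= q^-1 <= 1.
      have q1 : 1 <= `|q| by rewrite (le_trans w1) // ltW.
      have : `|q^-1| <= 1 by rewrite normfV invf_le1 // normr_gt0.
      by rewrite ler_norml.
    rewrite acosK // in ang circ.
    split; first exact: (sl q^-1).
    apply: mag => i t It Ct; rewrite (frenet_cov_velocity circ It Ct) /= scalerA.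
    congr (_ *: _).
    have D0 : 0 < q ^+ 2 - S.
      by rewrite subr_gt0 -w2 -(real_normK (num_real q)) ltr_pXn2r // nnegrE ltW.
    (* Thus |phi T| = sqrt (q^2 - S) / |q|, and kappa_1 times the coefficient of phi T is - |q| sgn
       q = - q. *)
    have -> : 1 - S * q^-1 ^+ 2 = (q ^+ 2 - S) / `|q| ^+ 2.
      by rewrite (real_normK (num_real q)); field.
    have r0 : Num.sqrt (q ^+ 2 - S) != 0 by rewrite gt_eqF // sqrtr_gt0.
    rewrite sqrtrM ?(ltW D0) // sqrtrV ?sqrtr_sqr ?normr_id ?sqr_ge0 //.
    rewrite -[in RHS]qE; field.
    by rewrite r0 normr_eq0 hq.
  - move=> [leg hel]; split; first by apply: (sl 0) => //; rewrite lerN10 ler01.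
    apply: mag => i t It Ct; rewrite (frenet_cov_velocity hel It Ct) /= scalerA.
    by rewrite mulrN qE.
  - move=> [theta [_ cth [_ ang] /= hel]].
    have D0 : 0 < 1 - S * cos theta ^+ 2.
      rewrite subr_gt0 -w2 -exprMn -(real_normK (num_real _)) normrM gtr0_norm //.
      rewrite expr_lt1 // ?mulr_ge0 ?(ltW w0) //.
      by rewrite -(mulfV (lt0r_neq0 w0)) ltr_pM2l.
    have r0 : Num.sqrt (1 - S * cos theta ^+ 2) != 0 by rewrite gt_eqF // sqrtr_gt0.
    split; first by apply: (sl (cos theta)) => //; rewrite cos_geN1 cos_le1.
    apply: mag => i t It Ct; rewrite (frenet_cov_velocity hel It Ct) /= scalerA.
    by rewrite -[in RHS]qE; congr (_ *: _); field.
move=> [[theta [th ang]] [_ mag]].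
pose c := cos theta.
(* If |phi T|^2 = 1 - S c^2 vanishes, the curve is of type a). Otherwise the coefficient 1 - q c of
   xibar in nabla_T (phi T) separates the circles from the helices. *)
have := cos_bound hunit ang hI0; rewrite -/c le0r => /orP[/eqP D0|D0].
  have fl := integral_of_extremal_angle hunit ang D0.
  apply: Or41; split.
    apply: frenet_geodesic => // i t It Ct; rewrite (mag i t It Ct).
    by have [F0 _] := fl i t (conj It Ct); rewrite F0 scaler0.
  have : (c * Num.sqrt S) ^+ 2 = 1 by rewrite exprMn w2; lra.
  move/eqP; rewrite sqrf_eq1 => /orP[] /eqP E; [left|right] => i t It Ct;
    rewrite (fl i t (conj It Ct)).2; congr (_ *: _).
    by rewrite -[RHS]mul1r -E mulfK // gt_eqF.
  by rewrite -[RHS]mul1r mulrN -mulNr -E mulfK // gt_eqF.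
have k10 := curvature1_gt0 hq D0; have E1 := curvature1_normal hq D0.
have N2 := normal_unit hq D0.
have [qc|qc] := eqVneq (1 - q * c) 0.
  have {}qc : q * c = 1 by lra.
  have cE : c = q^-1 by rewrite -[RHS]mulr1 -qc mulKf.
  (* The contact angle lies in [0, pi], hence is the principal value. *)
  have thE : acos q^-1 = theta by rewrite -cE cosK.
  have circ := magnetic_circle hs hM hIo hgamma hunit ang mag k10 qc E1
    (normal_circle D0 qc) N2.
  (* This gives both the stated form of kappa_1 and, by positivity of the left side, |q| > sqrt
     S. *)
  have qD : q ^+ 2 * (1 - S * c ^+ 2) = q ^+ 2 - S.
    by rewrite mulrBr mulr1 mulrCA -exprMn qc expr1n mulr1.
  have kE : Num.sqrt (q ^+ 2 - S) = `|q| * Num.sqrt (1 - S * c ^+ 2).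
    by rewrite -qD sqrtrM ?sqr_ge0 // sqrtr_sqr.
  have qS : 0 < q ^+ 2 - S by rewrite -qD mulr_gt0 // exprn_even_gt0.
  apply: Or42; rewrite thE kE; split.
  - by rewrite -(sqrtr_sqr q) ltr_sqrt ?exprn_even_gt0 // -subr_gt0.
  (* One time suffices: for a geodesic q phi T = 0 there, against |phi T| > 0. *)
  - move=> geo; have [t It] := hI0; have [i Ci] := chart_cover (gamma t).
    have := mag i t It Ci.
    rewrite (frenet_cov_velocity geo It Ci) /= scaler0 => /esym/eqP.
    rewrite scaler_eq0 oppr_eq0 (negPf hq) /= => /eqP F0.
    have := ip_phiT hunit ang (conj It Ci); rewrite F0 bform0l -/S -/c => D1.
    by move: D0; rewrite -D1 ltxx.
  - by [].
  - exact: circ.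
have hel := magnetic_helix hs hM hIo hgamma hunit ang mag k10
  (curvature2_gt0 S0 qc) E1 (curvature2_binormal S0 D0 qc)
  (normal_helix S0 D0 qc) (curvature2_normal q S0 D0) N2
  (binormal_unit S0 hq D0 qc).
have [c0|c0] := eqVneq c 0; last first.
  apply: Or44; exists theta; split.
  - by apply/eqP => th2; move: c0; rewrite /c th2 cos_pihalf eqxx.
  - rewrite -[ltRHS]mul1r ltr_pdivlMr // -[X in _ * X]gtr0_norm // -normrM.
    rewrite -(@expr_lt1 _ 2) ?normr_ge0 // real_normK ?num_real //.
    by rewrite exprMn w2 mulrC -subr_gt0.
  - by [].
  - exact: hel.
apply: Or43; split.
  by move=> i t It Ct a; rewrite (ang i t It Ct a) -/c c0.
(* At c = 0 both |phi T| and 1 - q c equal 1, hence so does the sign epsilon, and the frame and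
   curvatures of d) become those of c). *)
have r1 : Num.sqrt (1 - S * c ^+ 2) = 1.
  by rewrite c0 expr0n /= mulr0 subr0 sqrtr1.
move: hel; rewrite r1 c0 !mulr0 subr0 normr1 sgr1 !mulr1 divr1 mulN1r.
have -> // : (fun i t => (- Num.sg q / Num.sqrt S) *:
    (- (S * cos theta) *: velocity gamma i t + xibar i t)) =
  (fun i t => (- Num.sg q / Num.sqrt S) *: xibar i t).
by apply/funext => i; apply/funext => t; rewrite -/c c0 mulr0 oppr0 scale0r add0r.
Qed.
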